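(* Consider an arbitrary system of polynomial equations $f_1 = 0, \ldots, f_k = 0$. Suppose there is a refutation of this system in Extended Polynomial Calculus over $\mathbb{Z}$ with the square root rule, augmented by the eBVP rule, where the sum of the syntactic sizes of all polynomials in the derivation is equal to $S$. Then there is a refutation of the system $f_1 = 0, \ldots, f_k = 0$ in Extended Polynomial Calculus over $\mathbb{Z}$ augmented by the eBVP rule (without the square root rule) of size at most $\mathrm{poly}(S)$.
   Context: Polynomial Calculus over $R$ ($R=\mathbb{Z}$ or $\mathbb{Q}$) derives polynomials (read as equations $=0$) from axioms (including Boolean axioms $x_i^2-x_i$) by the rules $r_l=\alpha r_j+\beta r_k$ ($\alpha,\beta\in R$) and $r_l = x_i r_k$; a refutation ends with a nonzero constant. Extended Polynomial Calculus additionally allows extension axioms $y_j - q_j(\bar x, y_1,\ldots,y_{j-1})$ introducing new variables $y_j$. The square root rule allows deriving $r$ once $r^2$ has been derived. The eBVP rule allows deriving $g$ once $g\cdot(M + f_1 + 2f_2 + \ldots + 2^{t-1} f_t)$ and $f_1^2-f_1,\ldots,f_t^2-f_t$ have been derived, for an integer $M>0$. Size is the total bit size of coefficients. The syntactic size (length) of a polynomial in original and extension variables is that of its circuit representation (extension variables replaced by the circuits obtained by substituting their defining axioms into each other), where a constant $c$ has length $\lceil\log|c|\rceil$, a sum gate has length $\max(s,t)+1$ and a product gate $s+t+3$, with $s,t$ the lengths of its inputs. *)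

(* Defs.v *)
From HB Require Import structures.
From mathcomp Require Import all_boot all_order all_algebra.
From mathcomp Require Import finmap.
From mathcomp Require Import monalg.

Set Implicit Arguments.
Unset Strict Implicit.
Unset Printing Implicit Defensive.

Import Order.TTheory GRing.Theory Num.Theory.
Local Open Scope ring_scope.

(* [inl i] is the original variable x_i, [inr j] the extension variable y_j;
   both are numbered from 0. *)
Notation var n := ('I_n + nat)%type.
Notation epoly n := {malg int[{cmonom (var n)}]}.

Definition X (n : nat) (v : var n) : epoly n := << ucm v >>.

(* p is a polynomial in the x_i and y_0, ..., y_{k-1} only *)
Definition poly_below (n k : nat) (p : epoly n) : Prop :=
  forall (m : {cmonom (var n)}) (j : nat),
    m \in msupp p -> (k <= j)%N -> m (inr j) = 0%N.

(* qs = [:: q_0; q_1; ...] stands for the extension axioms y_j - q_j *)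
Definition extensions (n : nat) (qs : seq (epoly n)) : Prop :=
  forall j : nat, (j < size qs)%N -> poly_below j qs`_j.

(* [step sq fs qs ps r]: the line r follows from the previous lines ps; the
   square root rule is available iff [sq] holds. *)
Inductive step (n : nat) (sq : bool) (fs qs ps : seq (epoly n)) :
    epoly n -> Prop :=
| StepSystem (f : epoly n) :
    f \in fs -> step sq fs qs ps f
| StepBoolean (i : 'I_n) :
    step sq fs qs ps (X (inl i) ^+ 2 - X (inl i))
| StepExtension (j : nat) :
    (j < size qs)%N -> step sq fs qs ps (X (inr j) - qs`_j)
| StepLinear (a b : int) (p q : epoly n) :
    p \in ps -> q \in ps -> step sq fs qs ps (a *: p + b *: q)
| StepMul (v : var n) (p : epoly n) :
    p \in ps -> step sq fs qs ps (X v * p)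
| StepSqrt (r : epoly n) :
    sq -> r ^+ 2 \in ps -> step sq fs qs ps r
| StepEBVP (g : epoly n) (M : int) (hs : seq (epoly n)) :
    0 < M -> (0 < size hs)%N ->
    g * (M%:MP + \sum_(i < size hs) (2 ^+ i : int) *: hs`_i) \in ps ->
    (forall h : epoly n, h \in hs -> h ^+ 2 - h \in ps) ->
    step sq fs qs ps g.

Definition refutation (n : nat) (sq : bool) (fs qs rs : seq (epoly n)) : Prop :=
  [/\ extensions qs,
      forall l : nat, (l < size rs)%N ->
        poly_below (size qs) rs`_l /\ step sq fs qs (take l rs) rs`_l
    & exists2 c : int, c != 0 & last 0 rs = c%:MP].

(* number of binary digits of |c| (for c != 0), plus one bit for the sign *)
Definition bitsize (c : int) : nat := (trunc_log 2 `|c|%N).+2.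

Definition poly_size (n : nat) (p : epoly n) : nat :=
  (\sum_(m <- msupp p) bitsize p@_m)%N.

Definition refutation_size (n : nat) (rs : seq (epoly n)) : nat :=
  (\sum_(r <- rs) poly_size r)%N.

(* The length of a gate depends only on the lengths of its inputs, so that
   unfolding a circuit into a tree does not change it. *)
Inductive circuit (V : Type) : Type :=
| CVar of V
| CConst of int
| CAdd of circuit V & circuit V
| CMul of circuit V & circuit V.

(* [up_log 2 k] is the ceiling of log_2 k for k > 0, and 0 for k = 0 (the
   constant 0 has length 0). A variable has length 1. *)
Fixpoint circuit_length (V : Type) (C : circuit V) : nat :=
  match C with
  | CVar _ => 1
  | CConst c => up_log 2 `|c|%N
  | CAdd A B => (maxn (circuit_length A) (circuit_length B)).+1
  | CMul A B => (circuit_length A + circuit_length B + 3)%N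
  end.

Fixpoint circuit_subst (V W : Type) (s : V -> circuit W) (C : circuit V) :
    circuit W :=
  match C with
  | CVar v => s v
  | CConst c => CConst W c
  | CAdd A B => CAdd (circuit_subst s A) (circuit_subst s B)
  | CMul A B => CMul (circuit_subst s A) (circuit_subst s B)
  end.

(* ((C_1 op C_2) op C_3) op ...; [C0] is used for the empty list only *)
Definition circuit_fold (V : Type) (op : circuit V -> circuit V -> circuit V)
    (C0 : circuit V) (s : seq (circuit V)) : circuit V :=
  if s is C :: s' then foldl op C s' else C0.

(* product of the coefficient (omitted when it is 1) and of the variables, each
   repeated as many times as its exponent *)
Definition monomial_circuit (n : nat) (c : int) (m : {cmonom (var n)}) :
    circuit (var n) :=
  let vs := flatten [seq nseq (m v) (CVar v) | v <- enum_fset (finsupp m)] in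
  circuit_fold (@CMul _) (CConst _ 1)
    (if c == 1 then vs else CConst _ c :: vs).

(* The circuit of a polynomial is its expanded form, the monomials being added
   up one after the other. Since a sum has length max(s,t)+1, adding them up
   along a balanced tree would instead give a polynomial with N monomials a
   length of order log N, smaller than the polynomial itself. *)
Definition poly_circuit (n : nat) (p : epoly n) : circuit (var n) :=
  circuit_fold (@CAdd _) (CConst _ 0)
    [seq monomial_circuit p@_m m | m <- enum_fset (msupp p)].

(* replaces y_j by the j-th circuit of [env] *)
Definition expand (n : nat) (env : seq (circuit (var n)))
    (C : circuit (var n)) : circuit (var n) :=
  circuit_subst (fun v => if v is inr j then nth (CVar v) env j else CVar v) C.

(* circuits of y_0, y_1, ... in the original variables *)
Definition extension_circuits (n : nat) (qs : seq (epoly n)) :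
    seq (circuit (var n)) :=
  foldl (fun env q => rcons env (expand env (poly_circuit q))) [::] qs.

Definition syntactic_size (n : nat) (qs : seq (epoly n)) (p : epoly n) : nat :=
  circuit_length (expand (extension_circuits qs) (poly_circuit p)).

Definition refutation_syntactic_size (n : nat) (qs rs : seq (epoly n)) : nat :=
  (\sum_(r <- rs) syntactic_size qs r)%N.

(* Main.v *)
Require Import Defs.
From HB Require Import structures.
From mathcomp Require Import all_boot all_order all_algebra.
From mathcomp Require Import finmap.
From mathcomp Require Import monalg.
From mathcomp Require Import zify ring.

Set Implicit Arguments.
Unset Strict Implicit.
Unset Printing Implicit Defensive.

Import Order.TTheory GRing.Theory Num.Theory.
Local Open Scope ring_scope.

(** The square root rule is simulated by bit arithmetic. The bits of every used
    extension variable y_j are introduced as new extension variables, together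
    with short derivations of y_j = P - N, where P and N are nonnegative numbers
    written in binary; the circuit of a sum of two numbers of w bits has w + 1
    bits and that of a product w1 + w2 + 1 bits, so widths follow the syntactic
    lengths. Now let r^2 = 0 be derived and write r = P - N. Adding to P the
    bitwise complement of N gives r = D + 2^w e - 2^w + 1, where D has w bits and
    e is a bit, so that e r = e (1 + D). Hence e (1 + D)^2 = e r^2 = 0, and eBVP
    used twice gives e = 0. Then r = - D' for the bitwise complement D' of D, and
    D'^2 = 0 forces all bits of D' to vanish: the lowest bit a of D' = a + 2 E
    satisfies a (1 + 2 E)^2 = a D'^2 = 0, so that a = 0 by eBVP, and then
    4 E^2 = 0, whence E^2 = 0 by eBVP with M = 4.

    Extension variables whose axiom is not a line, or reads y_j = 0, are replaced
    by 0; the lines of syntactic length 0 are then 0, 1, -1 and variables, so that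
    the number of distinct lines is linear in the syntactic size. *)

(** The bit [e] is the carry of $P + (2^w - 1 - N)$, so it indicates $r > 0$. In that case $r$ is
    the positive number $1 + D$; eBVP says that such a number is not 0, and it is needed twice
    because it cancels one factor of $e (1 + D)^2$ at a time. In the other case $-r$ is the
    nonnegative number $D'$. Two obstacles shape the rest. Size is measured on expanded polynomials
    and the rules multiply by one variable only, so no line may expand a circuit into its bits: each
    line combines a few numbers that are linear in their bits, and multiplication by a polynomial is
    a derivation with a cost of its own. Moreover, lines of length 0 are free, so the syntactic size
    bounds neither their number nor the number of extension variables in them. Setting a variable to
    0 is harmless if its axiom is never a line, and if the axiom is $y_j = 0$ that line becomes 0.
    Each distinct image of a line is then derived only once. *)

(** * Size of polynomials *)

(* With the value 0 at 0, [poly_size] is subadditive and submultiplicative. *)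
Definition csize (c : int) : nat := if c == 0 then 0%N else bitsize c.

Lemma trunc_logD (a b : nat) : (0 < a)%N -> (0 < b)%N ->
  (trunc_log 2 (a + b) <= maxn (trunc_log 2 a) (trunc_log 2 b) + 1)%N.
Proof.
move=> a0 b0; rewrite addn1 -ltnS -(@ltn_exp2l 2) //.
apply: leq_ltn_trans (trunc_logP _ _) _ => //; first by rewrite addn_gt0 a0.
have A := trunc_log_ltn a (isT : (1 < 2)%N); have B := trunc_log_ltn b (isT : (1 < 2)%N).
have A' : (a < 2 ^ (maxn (trunc_log 2 a) (trunc_log 2 b)).+1)%N.
  by apply: leq_trans A _; rewrite leq_exp2l // ltnS leq_maxl.
have B' : (b < 2 ^ (maxn (trunc_log 2 a) (trunc_log 2 b)).+1)%N.
  by apply: leq_trans B _; rewrite leq_exp2l // ltnS leq_maxr.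
by rewrite (expnS _ _.+1); lia.
Qed.

Lemma trunc_logM (a b : nat) : (0 < a)%N -> (0 < b)%N ->
  (trunc_log 2 (a * b) <= trunc_log 2 a + trunc_log 2 b + 1)%N.
Proof.
move=> a0 b0; rewrite addn1 -ltnS -(@ltn_exp2l 2) //.
apply: leq_ltn_trans (trunc_logP _ _) _ => //; first by rewrite muln_gt0 a0.
have A := trunc_log_ltn a (isT : (1 < 2)%N); have B := trunc_log_ltn b (isT : (1 < 2)%N).
have -> : ((trunc_log 2 a + trunc_log 2 b).+2 = (trunc_log 2 a).+1 + (trunc_log 2 b).+1)%N by lia.
by rewrite expnD ltn_mul.
Qed.

Lemma trunc_log_mono (a b : nat) : (a <= b)%N -> (trunc_log 2 a <= trunc_log 2 b)%N.
Proof. by move/(leq_trunc_log 2). Qed.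

Lemma csizeD (a b : int) : (csize (a + b) <= csize a + csize b)%N.
Proof.
rewrite /csize; have [->|a0] := eqVneq a 0; first by rewrite add0r.
have [->|b0] := eqVneq b 0; first by rewrite addr0 (negPf a0) addn0.
case: ifP => // _; rewrite /bitsize.
have := @trunc_logD `|a|%N `|b|%N; rewrite !absz_gt0 => /(_ a0 b0).
have : (absz (a + b)%R <= absz a + absz b)%N by lia.
by move/trunc_log_mono; lia.
Qed.

(** A nonzero coefficient has size at least 2, so the product of the sizes absorbs the sum of the
    logarithms and the carry. *)
Lemma csizeM (a b : int) : (csize (a * b) <= csize a * csize b)%N.
Proof.
rewrite /csize; have [->|a0] := eqVneq a 0; first by rewrite mul0r.
have [->|b0] := eqVneq b 0; first by rewrite mulr0.
rewrite mulf_eq0 (negPf a0) (negPf b0) /= /bitsize abszM.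
have := @trunc_logM `|a|%N `|b|%N; rewrite !absz_gt0 => /(_ a0 b0).
nia.
Qed.

Lemma csizeN a : csize (- a) = csize a.
Proof. by rewrite /csize oppr_eq0 /bitsize abszN. Qed.

Section PolySize.
Variable n : nat.
Implicit Types p q : epoly n.

(** Polynomials with different supports can then be compared termwise over a common superset, since
    [csize] is 0 outside the support. *)
Lemma poly_sizeE p (d : {fset {cmonom (var n)}}) : (msupp p `<=` d)%fset ->
  poly_size p = (\sum_(m <- d) csize p@_m)%N.
Proof.
move=> le; rewrite /poly_size -(big_fset_incl _ le) /=; last first.
  by move=> m _ /mcoeff_outdom ->; rewrite /csize eqxx.
rewrite [LHS]big_seq [RHS]big_seq; apply: eq_bigr => m.
by rewrite /csize -mcoeff_neq0 => /negPf ->.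
Qed.

Lemma poly_sizeD p q : (poly_size (p + q) <= poly_size p + poly_size q)%N.
Proof.
rewrite (poly_sizeE (msuppD_le p q)) (poly_sizeE (fsubsetUl _ (msupp q))).
rewrite (poly_sizeE (fsubsetUr (msupp p) _)) -big_split /=.
by apply: leq_sum => m _; rewrite mcoeffD csizeD.
Qed.

Lemma poly_sizeN p : poly_size (- p) = poly_size p.
Proof.
rewrite (@poly_sizeE _ (msupp p)) ?msuppN // (@poly_sizeE p (msupp p)) //.
by apply: eq_bigr => m _; rewrite mcoeffN csizeN.
Qed.

Lemma poly_sizeB p q : (poly_size (p - q) <= poly_size p + poly_size q)%N.
Proof. by rewrite (leq_trans (poly_sizeD _ _)) // poly_sizeN. Qed.

Lemma poly_size0 : poly_size (0 : epoly n) = 0%N.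
Proof. by rewrite /poly_size msupp0 big_nil. Qed.

Lemma poly_sizeU c m : poly_size (<< c *g m >> : epoly n) = csize c.
Proof. by rewrite (poly_sizeE msuppU_le) big_seq_fset1 mcoeffUU. Qed.

Lemma poly_size_sum (I : Type) (r : seq I) (F : I -> epoly n) :
  (poly_size (\sum_(i <- r) F i) <= \sum_(i <- r) poly_size (F i))%N.
Proof.
elim: r => [|i r IH]; first by rewrite !big_nil poly_size0.
by rewrite !big_cons (leq_trans (poly_sizeD _ _)) // leq_add2l.
Qed.

Lemma poly_sizeUM_le c m q :
  (poly_size (<< c *g m >> * q) <= \sum_(m <- msupp q) csize (c * q@_m))%N.
Proof.
rewrite {1}(monalgE q) mulr_sumr (leq_trans (poly_size_sum _ _)) //.
by apply: leq_sum => m' _; rewrite malgM_def fgmulUU poly_sizeU.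
Qed.

Lemma poly_sizeUM c m q : (poly_size (<< c *g m >> * q) <= csize c * poly_size q)%N.
Proof.
rewrite (leq_trans (poly_sizeUM_le _ _ _)) // (@poly_sizeE q (msupp q)) //.
by rewrite big_distrr /=; apply: leq_sum => m' _; rewrite csizeM.
Qed.

Lemma poly_sizeXM v q : (poly_size (X v * q) <= poly_size q)%N.
Proof.
rewrite (leq_trans (poly_sizeUM_le _ _ _)) // (@poly_sizeE q (msupp q)) //.
by apply: leq_sum => m' _; rewrite mul1r.
Qed.

Lemma poly_sizeM p q : (poly_size (p * q) <= poly_size p * poly_size q)%N.
Proof.
rewrite {1}(monalgE p) mulr_suml (leq_trans (poly_size_sum _ _)) //.
rewrite [in leqRHS](@poly_sizeE p (msupp p)) // big_distrl /=.
by apply: leq_sum => m _; rewrite poly_sizeUM.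
Qed.

Lemma poly_sizeC c : poly_size (c%:MP : epoly n) = csize c.
Proof. exact: poly_sizeU. Qed.

Lemma poly_sizeX v : poly_size (X v : epoly n) = 2%N.
Proof. by rewrite poly_sizeU. Qed.

Lemma poly_sizeZ c q : (poly_size (c *: q) <= csize c * poly_size q)%N.
Proof. by rewrite -mul_malgC poly_sizeUM. Qed.

Implicit Types k : nat.

Lemma below0 k : poly_below k (0 : epoly n).
Proof. by move=> m j; rewrite msupp0 in_fset0. Qed.

Lemma belowW k k' p : (k <= k')%N -> poly_below k p -> poly_below k' p.
Proof. by move=> le H m j mp lj; apply: H mp (leq_trans le lj). Qed.

Lemma belowD k p q : poly_below k p -> poly_below k q -> poly_below k (p + q).
Proof.
move=> Hp Hq m j /(fsubsetP (msuppD_le _ _)); rewrite in_fsetU => /orP[].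
  exact: Hp.
exact: Hq.
Qed.

Lemma belowN k p : poly_below k p -> poly_below k (- p).
Proof. by move=> Hp m j; rewrite msuppN; apply: Hp. Qed.

Lemma belowB k p q : poly_below k p -> poly_below k q -> poly_below k (p - q).
Proof. by move=> Hp Hq; apply/belowD/belowN. Qed.

Lemma belowM k p q : poly_below k p -> poly_below k q -> poly_below k (p * q).
Proof.
move=> Hp Hq m j /msuppM_le [m1 [m2 [H1 H2 ->]]] kj.
by rewrite cmM (Hp _ _ H1 kj) (Hq _ _ H2 kj).
Qed.

Lemma belowC k c : poly_below k (c%:MP : epoly n).
Proof.
move=> m j /(fsubsetP (msuppC_le _)); rewrite in_fset1 => /eqP -> _.
by rewrite cm1.
Qed.

Lemma belowZ k c p : poly_below k p -> poly_below k (c *: p).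
Proof. by rewrite -mul_malgC => H; apply: belowM => //; apply: belowC. Qed.

Definition vbelow k (v : var n) : bool := if v is inr j then (j < k)%N else true.

Lemma belowX k v : vbelow k v -> poly_below k (X v).
Proof.
move=> H m j; rewrite /X msuppU1 in_fset1 => /eqP -> kj; rewrite cmU.
case: eqP => // E; move: H; rewrite E /=; lia.
Qed.

Lemma vbelowW k k' v : (k <= k')%N -> vbelow k v -> vbelow k' v.
Proof. by case: v => //= j le /leq_trans; apply. Qed.

Lemma below1 k : poly_below k (1 : epoly n).
Proof. by rewrite -mpolyC1E; apply: belowC. Qed.

Lemma below_nat k c : poly_below k (c%:R : epoly n).
Proof. by rewrite -mpolyC_nat; apply: belowC. Qed.

Lemma belowXn k p e : poly_below k p -> poly_below k (p ^+ e).
Proof.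
move=> H; elim: e => [|e IH]; first exact: below1.
by rewrite exprS; apply: belowM.
Qed.

Lemma below_sum k (I : eqType) (r : seq I) (F : I -> epoly n) :
  (forall i, i \in r -> poly_below k (F i)) -> poly_below k (\sum_(i <- r) F i).
Proof.
elim: r => [|i r IH] H; first by rewrite big_nil; apply: below0.
rewrite big_cons; apply: belowD; first by apply: H; rewrite mem_head.
by apply: IH => j jr; apply: H; rewrite in_cons jr orbT.
Qed.

End PolySize.

(** * Derivations and their cost *)

Section States.
Variables (n : nat) (fs : seq (epoly n)).
Implicit Types (p q r g h : epoly n) (v : var n) (c k N K M : nat).

Definition valid (qs ps : seq (epoly n)) : Prop :=
  extensions qs /\
  forall l, (l < size ps)%N ->
    poly_below (size qs) ps`_l /\ step false fs qs (take l ps) ps`_l.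

Record state := State { exts : seq (epoly n); lines : seq (epoly n);
                        validP : valid exts lines }.

(* An opaque wrapper: deciding membership in [lines s] by computation diverges. *)
Variant known (s : state) (p : epoly n) : Prop := Known of p \in lines s.

End States.

Notation "p 'known_in' s" := (known s p) (at level 70).

Section Derivations.
Variables (n : nat) (fs : seq (epoly n)).
Implicit Types (p q r g h : epoly n) (v : var n) (c k N K M : nat).
Implicit Types s t u : state fs.

Lemma step_mono (qs qs' ps ps' : seq (epoly n)) r :
  (exists e, qs' = qs ++ e) -> {subset ps <= ps'} ->
  step false fs qs ps r -> step false fs qs' ps' r.
Proof.
move=> [e ->] sub; case.
- exact: StepSystem.
- exact: StepBoolean.
- move=> j lj; have -> : qs`_j = (qs ++ e)`_j by rewrite nth_cat lj.
  by apply: StepExtension; rewrite size_cat ltn_addr.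
- by move=> a b p q Hp Hq; apply: StepLinear; apply: sub.
- by move=> v p Hp; apply: StepMul; apply: sub.
- by [].
- move=> g M hs M0 hs0 Hg Hh; apply: (@StepEBVP _ _ _ _ _ g M hs) => //.
    exact: sub.
  by move=> h /Hh /sub.
Qed.

(** Lines are compared as sets, since the rules only ask for membership. A new extension variable
    costs nothing by itself; only its axiom line does. *)
Definition grow c s t : Prop :=
  [/\ exists e, exts t = exts s ++ e, {subset lines s <= lines t}
    & (refutation_size (lines t) <= refutation_size (lines s) + c)%N].

Lemma grow_refl s : grow 0 s s.
Proof. by split => //; [exists [::]; rewrite cats0 | rewrite addn0]. Qed.

Lemma grow_trans c d s t u : grow c s t -> grow d t u -> grow (c + d) s u.
Proof.
move=> [[e E] S C] [[e' E'] S' C']; split.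
- by exists (e ++ e'); rewrite E' E catA.
- by move=> x /S /S'.
- by rewrite (leq_trans C') // addnA leq_add2r.
Qed.

Lemma growW c d s t : (c <= d)%N -> grow c s t -> grow d s t.
Proof. by move=> le [E S C]; split => //; rewrite (leq_trans C) // leq_add2l. Qed.

Lemma grow_size c s t : grow c s t -> (size (exts s) <= size (exts t))%N.
Proof. by case=> [[e ->] _ _]; rewrite size_cat leq_addr. Qed.

Lemma grow_mem c s t p : grow c s t -> p known_in s -> p known_in t.
Proof. by case=> _ S _ [/S]. Qed.

Lemma lines_below s p : p known_in s -> poly_below (size (exts s)) p.
Proof.
move=> [/(nthP 0) [l ll <-]].
by have [_ /(_ l ll) []] := validP s.
Qed.

Lemma valid_rcons s r : poly_below (size (exts s)) r ->
  step false fs (exts s) (lines s) r -> valid fs (exts s) (rcons (lines s) r).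
Proof.
have [Q H] := validP s; move=> B D; split => // l; rewrite size_rcons ltnS.
move=> ll; rewrite nth_rcons -cats1.
have [lt|ge] := ltnP l (size (lines s)).
  by rewrite takel_cat ?(ltnW lt) //; apply: H.
have -> : l = size (lines s) by apply/eqP; rewrite eqn_leq ll ge.
by rewrite eqxx take_size_cat.
Qed.

Lemma add_line s r : poly_below (size (exts s)) r ->
  step false fs (exts s) (lines s) r ->
  exists2 t, grow (poly_size r) s t & r known_in t.
Proof.
move=> B D; exists (State (valid_rcons B D)) => /=.
  split => /=; first by exists [::]; rewrite cats0.
    by move=> x; rewrite mem_rcons in_cons => ->; rewrite orbT.
  by rewrite /refutation_size -cats1 big_cat big_seq1.
by constructor; rewrite /= mem_rcons mem_head.
Qed.

Lemma valid_ext s q : poly_below (size (exts s)) q ->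
  valid fs (rcons (exts s) q) (lines s).
Proof.
have [Q H] := validP s; move=> B; split.
  move=> j; rewrite size_rcons ltnS nth_rcons => lj.
  have [lt|ge] := ltnP j (size (exts s)); first exact: Q.
  have -> : j = size (exts s) by apply/eqP; rewrite eqn_leq lj ge.
  by rewrite eqxx.
move=> l /H [Bl Sl]; split; first by apply: belowW Bl; rewrite size_rcons.
by apply: step_mono Sl => //; exists [:: q]; rewrite cats1.
Qed.

(** The new variable takes the first free index, so its definition may use every earlier variable
    and the earlier steps stay valid. *)
Lemma fresh s q : poly_below (size (exts s)) q ->
  exists2 t, grow (2 + poly_size q) s t &
    exists2 v, vbelow (size (exts t)) v & X v - q known_in t.
Proof.
move=> B; pose s1 := State (valid_ext B); pose v : var n := inr (size (exts s)).
have [||t g h] := @add_line s1 (X v - q).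
- rewrite /= size_rcons; apply: belowB; last by apply: (belowW _ B).
  by apply: belowX; rewrite /= ltnS.
- have := @StepExtension _ false fs (exts s1) (lines s1) (size (exts s)).
  by rewrite /= size_rcons nth_rcons ltnn eqxx => /(_ (ltnSn _)).
have g1 : grow 0 s s1.
  by split => //=; [exists [:: q]; rewrite cats1 | rewrite addn0].
have le : (poly_size (X v - q) <= 2 + poly_size q)%N.
  by rewrite (leq_trans (poly_sizeD _ _)) // poly_sizeN poly_sizeX.
exists t; first exact: growW le (grow_trans g1 g).
exists v => //; apply: vbelowW (grow_size g) _.
by rewrite /= size_rcons /=.
Qed.

(* Derivability from every later state, so that derivations made from the same
   state can be concatenated. *)
Definition der s c N p : Prop :=
  (poly_size p <= N)%N /\
  forall d t, grow d s t -> exists2 u, grow c t u & p known_in u.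

Lemma der_mem s p : p known_in s -> der s 0 (poly_size p) p.
Proof.
by move=> H; split=> // d t g; exists t; [apply: grow_refl | apply: grow_mem g H].
Qed.

Lemma derW c N s c' N' p : der s c N p -> (c <= c')%N -> (N <= N')%N -> der s c' N' p.
Proof.
move=> [B H] lc lN; split; first exact: leq_trans lN.
by move=> d t /H [u g m]; exists u => //; apply: growW g.
Qed.

Lemma der_grow d s t c N p : grow d s t -> der s c N p -> der t c N p.
Proof.
by move=> g [B H]; split=> // d' u g'; apply: H (grow_trans g g').
Qed.

Lemma der_exec s c N p : der s c N p -> exists2 t, grow c s t & p known_in t.
Proof. by move=> [_ /(_ _ _ (grow_refl s))]. Qed.

Lemma der_lin s c1 N1 c2 N2 p q N (a b : int) :
  der s c1 N1 p -> der s c2 N2 q -> (poly_size (a *: p + b *: q)%R <= N)%N ->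
  der s (c1 + c2 + N) N (a *: p + b *: q).
Proof.
move=> [Bp Hp] [Bq Hq] le; split=> // d t g.
have [t1 g1 m1] := Hp _ _ g.
have [t2 g2 m2] := Hq _ _ (grow_trans g g1).
have m1' := grow_mem g2 m1.
have [||t3 g3 m3] := @add_line t2 (a *: p + b *: q).
- by apply: belowD; apply: belowZ; apply: lines_below.
- by case: m1' m2 => ? [?]; apply: StepLinear.
exists t3 => //; exact: growW (grow_trans (grow_trans g1 g2) (growW le g3)).
Qed.

Lemma derD s c1 N1 c2 N2 p q : der s c1 N1 p -> der s c2 N2 q ->
  der s (c1 + c2 + (N1 + N2)) (N1 + N2) (p + q).
Proof.
move=> Hp Hq; have := der_lin (a := 1) (b := 1) Hp Hq; rewrite !scale1r; apply.
by rewrite (leq_trans (poly_sizeD _ _)) // leq_add ?Hp.1 ?Hq.1.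
Qed.

Lemma derB s c1 N1 c2 N2 p q : der s c1 N1 p -> der s c2 N2 q ->
  der s (c1 + c2 + (N1 + N2)) (N1 + N2) (p - q).
Proof.
move=> Hp Hq; have := der_lin (a := 1) (b := -1) Hp Hq.
rewrite scale1r scaleN1r; apply.
by rewrite (leq_trans (poly_sizeD _ _)) // poly_sizeN leq_add ?Hp.1 ?Hq.1.
Qed.

Lemma derN s c1 N1 p : der s c1 N1 p -> der s (c1 + c1 + N1) N1 (- p).
Proof.
move=> Hp; have := der_lin (a := -1) (b := 0) Hp Hp.
rewrite scale0r addr0 scaleN1r; apply.
by rewrite poly_sizeN Hp.1.
Qed.

Lemma der_XM s c N p v : vbelow (size (exts s)) v -> der s c N p ->
  der s (c + N) N (X v * p).
Proof.
move=> vb [B H]; have le := leq_trans (poly_sizeXM v p) B; split=> // d t g.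
have [t1 g1 m1] := H _ _ g.
have [||t2 g2 m2] := @add_line t1 (X v * p).
- apply: belowM; last exact: lines_below.
  by apply: belowX; apply: vbelowW vb; apply: grow_size (grow_trans g g1).
- by case: m1 => ?; apply: StepMul.
exists t2 => //; exact: growW (grow_trans g1 (growW le g2)).
Qed.

(** The rules multiply by a variable only, so multiplying by [g] is a derivation that follows the
    construction of [g]. Its cost is linear in the size of the multiplied line, with factor [K]. The
    bound [k] on the extension variables, instead of a fixed state, keeps [g] usable in all later
    states. *)
Definition mulby k N K g : Prop :=
  [/\ poly_below k g, (poly_size g <= N)%N &
   forall s M p, (k <= size (exts s))%N -> p known_in s ->
     (poly_size p <= M)%N -> der s (K * M) (N * M) (g * p)].

Lemma der_mul k N K g s c M p : mulby k N K g -> (k <= size (exts s))%N ->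
  der s c M p -> der s (c + K * M) (N * M) (g * p).
Proof.
case=> Bg Sg Hg ks [Bp Hp]; split.
  by rewrite (leq_trans (poly_sizeM _ _)) // leq_mul.
move=> d t g1; have [t1 g2 m1] := Hp _ _ g1.
have ks1 := leq_trans ks (grow_size (grow_trans g1 g2)).
have [t2 g3 m2] := der_exec (Hg _ _ _ ks1 m1 Bp).
by exists t2 => //; apply: grow_trans g2 g3.
Qed.

Lemma mulbyW k N K k' N' K' g : mulby k N K g ->
  (k <= k')%N -> (N <= N')%N -> (K <= K')%N -> mulby k' N' K' g.
Proof.
case=> B S H lk lN lK; split; first exact: belowW B.
  exact: leq_trans lN.
move=> s M p ls D le; apply: derW (H _ _ _ (leq_trans lk ls) D le) _ _.
  by rewrite leq_mul2r lK orbT.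
by rewrite leq_mul2r lN orbT.
Qed.

Lemma der_line s p M : p known_in s -> (poly_size p <= M)%N -> der s 0 M p.
Proof. by move=> /der_mem D le; apply: derW D _ _. Qed.

Lemma mulby_XM k N K v g : vbelow k v -> mulby k N K g -> mulby k N (K + N) (X v * g).
Proof.
move=> vb [B S H]; split; first by apply: belowM => //; apply: belowX.
  exact: leq_trans (poly_sizeXM _ _) S.
move=> s M p ls D le; rewrite -mulrA mulnDl.
by apply: der_XM; [apply: vbelowW vb | apply: H].
Qed.

Lemma mulbyD k N1 K1 N2 K2 g1 g2 : mulby k N1 K1 g1 -> mulby k N2 K2 g2 ->
  mulby k (N1 + N2) (K1 + K2 + (N1 + N2)) (g1 + g2).
Proof.
case=> B1 S1 H1 [B2 S2 H2]; split; first exact: belowD.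
  by rewrite (leq_trans (poly_sizeD _ _)) // leq_add.
move=> s M p ls D le; rewrite mulrDl !mulnDl.
by apply: derD; [apply: H1|apply: H2].
Qed.

Lemma mulbyN k N K g : mulby k N K g -> mulby k N (K + N) (- g).
Proof.
case=> B S H; split; first exact: belowN.
  by rewrite poly_sizeN.
move=> s M p ls D le; rewrite mulNr mulnDl -[(K * M)%N]addn0.
have := der_lin (a := -1) (b := 0) (H _ _ _ ls D le) (der_mem D).
rewrite scale0r addr0 scaleN1r; apply.
by rewrite poly_sizeN; case: (H _ _ _ ls D le).
Qed.

Lemma mulbyM k N1 K1 N2 K2 g1 g2 : mulby k N1 K1 g1 -> mulby k N2 K2 g2 ->
  mulby k (N1 * N2) (K2 + K1 * N2) (g1 * g2).
Proof.
move=> M1 [B2 S2 H2]; have [B1 S1 _] := M1; split; first exact: belowM.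
  by rewrite (leq_trans (poly_sizeM _ _)) // leq_mul.
move=> s M p ls D le; rewrite -mulrA mulnDl -!mulnA.
by apply: der_mul M1 ls (H2 _ _ _ ls D le).
Qed.

Lemma mulbyC k (c : int) : mulby k (csize c) (csize c) (c%:MP).
Proof.
split; [exact: belowC | by rewrite poly_sizeC |].
move=> s M p ls D le; rewrite mul_malgC.
have := der_lin (a := c) (b := 0) (der_mem D) (der_mem D).
rewrite scale0r addr0; apply.
by rewrite (leq_trans (poly_sizeZ _ _)) // leq_mul.
Qed.

Lemma mulby1 k : mulby k 2 2 1.
Proof. by rewrite -mpolyC1E; apply: mulbyC. Qed.

Lemma mulbyX k v : vbelow k v -> mulby k 2 4 (X v).
Proof. by move=> vb; rewrite -[X v]mulr1; apply: mulby_XM (mulby1 k). Qed.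

Lemma mulby2 k : mulby k 3 3 2%:R.
Proof. by rewrite -mpolyC_nat; apply: mulbyC. Qed.

Lemma mulby4 k : mulby k 4 4 4%:R.
Proof. by rewrite -mpolyC_nat; apply: mulbyC. Qed.

(** * Numbers in binary and the eBVP rule *)

Definition binval (A : seq (var n)) : epoly n := foldr (fun a x => X a + 2%:R * x) 0 A.

Definition bit s v := vbelow (size (exts s)) v /\ X v ^+ 2 - X v known_in s.

Lemma bit_grow c s t v : grow c s t -> bit s v -> bit t v.
Proof. by move=> g [B H]; split; [apply: vbelowW (grow_size g) B | apply: grow_mem g H]. Qed.

Lemma binval_cons a A : binval (a :: A) = X a + 2%:R * binval A.
Proof. by []. Qed.

Lemma scale2 p : (2 : int) *: p = 2%:R * p.
Proof. by rewrite scaler_nat mulr_natl. Qed.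

Lemma scale_2S p i : (2 ^+ i.+1 : int) *: p = 2%:R * ((2 ^+ i : int) *: p).
Proof. rewrite exprS -scalerA scale2; reflexivity. Qed.

(** The rule is stated with an explicit sum of powers of two, whereas the arithmetic below recurses
    on the Horner form, lowest bit first. *)
Lemma binval_sum A : binval A = \sum_(i < size A) (2 ^+ i : int) *: (map (@X n) A)`_i.
Proof.
elim: A => [|a A IH]; first by rewrite big_ord0; reflexivity.
rewrite big_ord_recl expr0 scale1r [binval _]/= IH mulr_sumr.
apply: (congr2 +%R); first reflexivity.
apply: eq_bigr => i _; rewrite lift0 scale_2S; reflexivity.
Qed.

Lemma der_ebvp s c N g (M : int) A : 0 < M -> (0 < size A)%N ->
  (forall v, v \in A -> bit s v) -> poly_below (size (exts s)) g ->
  der s c N (g * (M%:MP + binval A)) -> der s (c + poly_size g) (poly_size g) g.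
Proof.
move=> M0 A0 HA Bg [_ H]; split=> // d t gr.
have [t1 g1 m1] := H _ _ gr; have g2 := grow_trans gr g1.
have [||t2 g3 m2] := @add_line t1 g.
- by apply: belowW Bg; apply: grow_size g2.
- apply: (@StepEBVP _ _ _ _ _ g M (map (@X n) A) M0).
  + by rewrite size_map.
  + by rewrite size_map -binval_sum; case: m1.
  + by move=> h /mapP [v /HA [_ Hv] ->]; case: (grow_mem g2 Hv).
exists t2 => //; exact: grow_trans g1 g3.
Qed.

Lemma der_eq s c N p q : der s c N p -> p = q -> der s c N q.
Proof. by move=> D <-. Qed.

End Derivations.

Ltac poly_ring :=
  rewrite ?binval_cons;
  repeat match goal with
  | |- context [X ?v] => generalize (X v); intro
  | |- context [binval ?A] => generalize (binval A); intro
  end; ring.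

(** A derivation is assembled as an explicit combination of known lines; the polynomial it yields is
    then identified with the intended one by [ring]. *)
Ltac der_as D q' := apply der_eq with (q := q') in D; [ | poly_ring].


(** * Binary arithmetic *)

Section Gates.
Variables (n : nat) (fs : seq (epoly n)).
Implicit Types (s t u : state fs) (p q r g h : epoly n) (v z : var n) (c k N K M : nat).

(** The new variable inherits the bit equation through $v^2 - v = (v + Q - 1)(v - Q) + (Q^2 -
    Q)$. *)
Lemma gate s Q N K c M : mulby fs (size (exts s)) N K Q -> der s c M (Q ^+ 2 - Q) ->
  exists t v, [/\ grow ((2 + N) * (3 * N + K + 7) + c + M) s t, bit t v
                & X v - Q known_in t].
Proof.
move=> mQ DQ; have [B S _] := mQ.
have [t g [v vb m]] := fresh B.
have le : (poly_size (X v - Q)%R <= 2 + N)%N.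
  by rewrite (leq_trans (poly_sizeD _ _)) // poly_sizeN poly_sizeX leq_add2l.
have D0 := der_line m le.
have D1 := der_XM vb D0.
have D2 := der_mul mQ (grow_size g) D0.
have D3 := derD (derB (derD D1 D2) D0) (der_grow g DQ).
have [t1 g1 m1] := der_exec D3.
have g2 := grow_trans g g1.
exists t1, v; split.
- by apply: growW g2; nia.
- split; first exact: vbelowW (grow_size g1) vb.
  rewrite (_ : _ - _ = X v * (X v - Q) + Q * (X v - Q) - (X v - Q) + (Q ^+ 2 - Q)) //.
  by poly_ring.
- exact: grow_mem g1 m.
Qed.

Definition zerov s z := bit s z /\ X z known_in s.

Lemma zerov_grow c s t z : grow c s t -> zerov s z -> zerov t z.
Proof. by move=> g [B m]; split; [apply: bit_grow g B | apply: grow_mem g m]. Qed.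

Lemma der0 s z : zerov s z -> der s 0 0 0.
Proof.
move=> [_ m]; have := der_lin (a := 0) (b := 0) (N := 0) (der_mem m) (der_mem m).
by rewrite !scale0r addr0 poly_size0; apply.
Qed.

Lemma zero_gate s : exists t z, grow 20 s t /\ zerov t z.
Proof.
have [t g [z vb m]] := fresh (@below0 n (size (exts s))).
rewrite subr0 in m.
have D0 : der t 0 2 (X z) by apply: der_line m _; rewrite poly_sizeX.
have [t1 g1 m1] := der_exec (derB (der_XM vb D0) D0).
exists t1, z; split.
  by apply: growW (grow_trans g g1); rewrite poly_size0.
split; last exact: grow_mem g1 m.
by split => //; apply: vbelowW (grow_size g1) vb.
Qed.

Lemma bit_mulby s v : bit s v -> mulby fs (size (exts s)) 2 4 (X v).
Proof. by case=> vb _; apply: mulbyX. Qed.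

Lemma bit_der s v : bit s v -> der s 0 4 (X v ^+ 2 - X v).
Proof.
case=> _ m; apply: der_line m _.
rewrite (leq_trans (poly_sizeD _ _)) // poly_sizeN expr2.
by rewrite (leq_trans (leq_add (poly_sizeXM _ _) (leqnn _))) // !poly_sizeX.
Qed.

Lemma not_gate s a : bit s a ->
  exists t v, [/\ grow 1000 s t, bit t v & X v - (1 - X a) known_in t].
Proof.
move=> Ba; have mQ := mulbyD (mulby1 fs _) (mulbyN (bit_mulby Ba)).
have DQ : der s 0 4 ((1 - X a) ^+ 2 - (1 - X a)).
  by rewrite (_ : _ - _ = X a ^+ 2 - X a); [apply: bit_der | poly_ring].
have [t [v [g B m]]] := gate mQ DQ.
by exists t, v; split => //; apply: growW g.
Qed.

Lemma and_gate s a b : bit s a -> bit s b ->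
  exists t v, [/\ grow 1000 s t, bit t v & X v - X a * X b known_in t].
Proof.
move=> Ba Bb; have ma := bit_mulby Ba; have mb := bit_mulby Bb.
have DQ := derD (der_mul (mulbyM mb mb) (leqnn _) (bit_der Ba))
                (der_mul ma (leqnn _) (bit_der Bb)).
der_as DQ ((X a * X b) ^+ 2 - X a * X b).
have [t [v [g B m]]] := gate (mulbyM ma mb) DQ.
by exists t, v; split => //; apply: growW g.
Qed.

Lemma xor_gate s a b : bit s a -> bit s b ->
  exists t v, [/\ grow 10000 s t, bit t v
                & X v - (X a + X b - 2%:R * (X a * X b)) known_in t].
Proof.
move=> Ba Bb; have ma := bit_mulby Ba; have mb := bit_mulby Bb.
(* The cofactor of $a^2 - a$ is $1 + 4b(b - 1) = (1 - 2b)^2$, because the exclusive or is $b + (1 -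
   2b)a$. *)
have mg := mulbyD (mulby1 fs _)
  (mulbyM (mulby4 fs _) (mulbyM mb (mulbyD mb (mulbyN (mulby1 fs _))))).
have DQ := derD (der_mul mg (leqnn _) (bit_der Ba)) (bit_der Bb).
have mQ := mulbyD (mulbyD ma mb) (mulbyN (mulbyM (mulby2 fs _) (mulbyM ma mb))).
der_as DQ ((X a + X b - 2%:R * (X a * X b)) ^+ 2 - (X a + X b - 2%:R * (X a * X b))).
have [t [v [g B m]]] := gate mQ DQ.
by exists t, v; split => //; apply: growW g.
Qed.

End Gates.

Section Adders.
Variables (n : nat) (fs : seq (epoly n)).
Implicit Types (s t u : state fs) (p q r g h : epoly n) (a b v z : var n) (N K M : nat).
Implicit Types (A B P Q : seq (var n)).

Lemma line_mulby s k N K (Q : epoly n) v : mulby fs k N K Q -> X v - Q known_in s ->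
  der s 0 (2 + N) (X v - Q).
Proof.
case=> _ S _ m; apply: der_line m _.
by rewrite (leq_trans (poly_sizeD _ _)) // poly_sizeN poly_sizeX leq_add2l.
Qed.

(** Let $x$ be the exclusive or of $a$ and $b$, and let $y = ab$, $y' = cx$. The carry can be
    defined as the sum $y + y'$: it is a bit because $y$ and $y'$ are never both 1. *)
Lemma full_adder s a b c : bit s a -> bit s b -> bit s c ->
  exists t v w, [/\ grow (30 * 1000) s t, bit t v, bit t w
    & X a + X b + X c - X v - 2%:R * X w known_in t].
Proof.
move=> Ba Bb Bc.
have [t1 [x [g1 Bx Lx]]] := xor_gate Ba Bb.
have {}Ba := bit_grow g1 Ba; have {}Bb := bit_grow g1 Bb; have {}Bc := bit_grow g1 Bc.
have [t2 [y [g2 By Ly]]] := and_gate Ba Bb.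
have {}Ba := bit_grow g2 Ba; have {}Bb := bit_grow g2 Bb; have {}Bc := bit_grow g2 Bc.
have {}Bx := bit_grow g2 Bx; have {}Lx := grow_mem g2 Lx.
have [t3 [v [g3 Bv Lv]]] := xor_gate Bx Bc.
have {}Ba := bit_grow g3 Ba; have {}Bb := bit_grow g3 Bb; have {}Bc := bit_grow g3 Bc.
have {}Bx := bit_grow g3 Bx; have {}Lx := grow_mem g3 Lx.
have {}By := bit_grow g3 By; have {}Ly := grow_mem g3 Ly.
have [t4 [y' [g4 By' Ly']]] := and_gate Bc Bx.
have {}Ba := bit_grow g4 Ba; have {}Bb := bit_grow g4 Bb; have {}Bc := bit_grow g4 Bc.
have {}Bx := bit_grow g4 Bx; have {}Lx := grow_mem g4 Lx.
have {}By := bit_grow g4 By; have {}Ly := grow_mem g4 Ly.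
have {}Bv := bit_grow g4 Bv; have {}Lv := grow_mem g4 Lv.
have ma := bit_mulby Ba; have mb := bit_mulby Bb; have mc := bit_mulby Bc.
have mx := bit_mulby Bx; have my := bit_mulby By.
have m2 := mulby2 fs (size (exts t4)).
have mxor := mulbyD (mulbyD ma mb) (mulbyN (mulbyM m2 (mulbyM ma mb))).
have {}Lx := line_mulby mxor Lx.
have {}Ly := line_mulby (mulbyM ma mb) Ly.
have {}Lv := line_mulby (mulbyD (mulbyD mx mc) (mulbyN (mulbyM m2 (mulbyM mx mc)))) Lv.
have {}Ly' := line_mulby (mulbyM mc mx) Ly'.
have mb' := mulbyM mb (mulbyD (mulby1 fs _) (mulbyN (mulbyM m2 mb))).
(* [D1] is $xy - ab(a + b - 2ab)$ and [D2] is $ab(a + b - 2ab)$, so together they give $xy$. Then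
   [D3] is $yy'$, and twice [D3] supplies the mixed term of $(y + y')^2$. *)
have D1 := derD (der_mul mx (leqnn _) Ly) (der_mul (mulbyM ma mb) (leqnn _) Lx).
have D2 := derB (der_mul mb' (leqnn _) (bit_der Ba)) (der_mul ma (leqnn _) (bit_der Bb)).
have D3 := derD (der_mul my (leqnn _) Ly') (der_mul mc (leqnn _) (derD D1 D2)).
have D4 := derD (derD (bit_der By) (bit_der By')) (der_mul m2 (leqnn _) D3).
der_as D4 ((X y + X y') ^+ 2 - (X y + X y')).
have my' := bit_mulby By'.
have [t5 [w [g5 Bw Lw]]] := gate (mulbyD my my') D4.
have {}Lw := line_mulby (mulbyD my my') Lw.
have D5 := derB (derB (derB (derN (der_grow g5 Lx)) (der_grow g5 Lv))
  (der_mul m2 (grow_size g5) Lw)) (der_mul m2 (grow_size g5) (der_grow g5 (derD Ly Ly'))).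
der_as D5 (X a + X b + X c - X v - 2%:R * X w).
have [t6 g6 m6] := der_exec D5.
exists t6, v, w; split.
- apply: growW (grow_trans (grow_trans (grow_trans (grow_trans (grow_trans g1 g2) g3) g4) g5) g6).
  by vm_compute.
- exact: bit_grow (grow_trans g5 g6) Bv.
- exact: bit_grow g6 Bw.
- exact: m6.
Qed.

End Adders.

Section Bits.
Variables (n : nat) (fs : seq (epoly n)).
Implicit Types (s t u : state fs) (p q r g h : epoly n) (a b v z o : var n) (w N K M W : nat).
Implicit Types (A B C P Q : seq (var n)).

Definition bits s A := forall v, v \in A -> bit s v.

Lemma bits_grow c s t A : grow c s t -> bits s A -> bits t A.
Proof. by move=> g H v /H; apply: bit_grow g. Qed.

Lemma bits_nil s : bits s [::].
Proof. by []. Qed.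

Lemma bits_cons s a A : bits s (a :: A) <-> bit s a /\ bits s A.
Proof.
split=> [H|[H1 H2] v].
  split; first by apply: H; rewrite mem_head.
  by move=> v vA; apply: H; rewrite in_cons vA orbT.
by rewrite in_cons => /orP[/eqP ->|/H2].
Qed.

Lemma poly_size_scale_binval i A :
  (poly_size ((2 ^+ i : int) *: binval A) <= size A * (i + size A + 2))%N.
Proof.
elim: A i => [|a A IH] i; first by rewrite /= scaler0 poly_size0.
rewrite [binval _]/= scalerDr -scale2 scalerA -exprSr.
rewrite (leq_trans (poly_sizeD _ _)) //.
have H1 : (poly_size ((2 ^+ i : int) *: X a) <= i + 2)%N.
  rewrite -mul_malgC /X malgM_def fgmulUU poly_sizeU mulr1 /csize.
  rewrite expf_eq0 andbF /bitsize abszX trunc_expnK //.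
  by rewrite addn2.
have H2 := IH i.+1.
rewrite [size (a :: A)]/=; nia.
Qed.

Lemma poly_size_binval A : (poly_size (binval A) <= size A * (size A + 2))%N.
Proof. by have := poly_size_scale_binval 0 A; rewrite expr0 scale1r. Qed.

(** The size bound is supplied for the result itself: computed from the bounds of the summands, it
    would grow exponentially along a recursion on the bits. *)
Lemma der_lin2 s c1 N1 c2 N2 p q r N : der s c1 N1 p -> der s c2 N2 q ->
  p + 2%:R * q = r -> (poly_size r <= N)%N -> der s (c1 + c2 + N) N r.
Proof.
move=> Hp Hq <- le; have := der_lin (a := 1) (b := 2) Hp Hq.
by rewrite scale1r scale2; apply.
Qed.

Definition base s z o := [/\ zerov s z, bit s o & X o - 1 known_in s].

Lemma base_grow c s t z o : grow c s t -> base s z o -> base t z o.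
Proof.
move=> g [Z B L]; split; [exact: zerov_grow g Z | exact: bit_grow g B | exact: grow_mem g L].
Qed.

(* Signed numbers: a difference of two numbers of w bits. *)
Definition rep s w p := exists P Q,
  [/\ bits s P, bits s Q, size P = w, size Q = w & p - (binval P - binval Q) known_in s].

Lemma rep_grow c s t w p : grow c s t -> rep s w p -> rep t w p.
Proof.
move=> g [P [Q [BP BQ sP sQ L]]]; exists P, Q.
split; [exact: bits_grow g BP | exact: bits_grow g BQ | exact: sP | exact: sQ | exact: grow_mem g L].
Qed.

End Bits.

Ltac lift g :=
  match type of g with grow _ ?s ?t => repeat match goal with
  | H : bit s _ |- _ => apply (bit_grow g) in H
  | H : bits s _ |- _ => apply (bits_grow g) in H
  | H : zerov s _ |- _ => apply (zerov_grow g) in H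
  | H : base s _ _ |- _ => apply (base_grow g) in H
  | H : rep s _ _ |- _ => apply (rep_grow g) in H
  | H : known s _ |- _ => apply (grow_mem g) in H
  | H : der s _ _ _ |- _ => apply (der_grow g) in H
  end end.

Section Arithmetic.
Variables (n : nat) (fs : seq (epoly n)).
Implicit Types (s t u : state fs) (p q r g h : epoly n) (a b v z : var n) (N K M W : nat).
Implicit Types (A B C P Q : seq (var n)).

(** A number of $k$ bits has size at most $k(k + 2)$; here $k = W + 1$, since a sum of two numbers
    of $W$ bits has one bit more. *)
Definition binval_bound W : nat := (W.+1 * W.+3)%N.

Lemma poly_size_binval_le W A : (size A <= W.+1)%N -> (poly_size (binval A) <= binval_bound W)%N.
Proof. by move=> le; rewrite (leq_trans (poly_size_binval A)) // /binval_bound leq_mul // addn2 !ltnS. Qed.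

(** Ripple-carry addition: [c] is the carry-in, generalized for the induction, and the last carry
    becomes the top bit. *)
Lemma add_bits W s z A B c : zerov s z -> size A = size B -> (size A <= W)%N ->
  bits s A -> bits s B -> bit s c ->
  exists t C, [/\ grow (size A * (30 * 1000 + 3 * binval_bound W + 2)) s t, bits t C, size C = (size A).+1
    & binval A + binval B + X c - binval C known_in t].
Proof.
elim: A B c s => [|a A IH] [|b B] // c s Zz /=.
  move=> _ _ _ _ Bc; have [t g m] := der_exec (der0 Zz).
  exists t, [:: c]; split; [exact: g | | by [] | ].
  - by move=> v; rewrite inE => /eqP ->; apply: bit_grow g Bc.
  - have -> : binval [::] + binval [::] + X c - binval [:: c] = 0 by rewrite /=; poly_ring.
    exact: m.
move=> [sz] leW /bits_cons [Ba BA] /bits_cons [Bb BB] Bc.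
have [t1 [v [w [g1 Bv Bw L1]]]] := full_adder Ba Bb Bc; lift g1.
have [t2 [C [g2 BC sC L2]]] := IH B w t1 Zz sz (ltnW leW) BA BB Bw; lift g2.
have E : (X a + X b + X c - X v - 2%:R * X w) + 2%:R * (binval A + binval B + X w - binval C)
   = binval (a :: A) + binval (b :: B) + X c - binval (v :: C) by rewrite /=; poly_ring.
have le : (poly_size (binval (a :: A) + binval (b :: B) + X c - binval (v :: C)) <= 3 * binval_bound W + 2)%N.
  have H1 := poly_size_binval_le (A := a :: A) (leqW leW).
  have H2 : (poly_size (binval (b :: B)) <= binval_bound W)%N.
    by apply: poly_size_binval_le; rewrite /= -sz leqW.
  have H3 : (poly_size (binval (v :: C)) <= binval_bound W)%N.
    by apply: poly_size_binval_le; rewrite /= sC ltnS.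
  have S1 := poly_sizeD (binval (a :: A)) (binval (b :: B)).
  have S2 := poly_sizeD (binval (a :: A) + binval (b :: B)) (X c).
  have S3 := poly_sizeB (binval (a :: A) + binval (b :: B) + X c) (binval (v :: C)).
  move: S1 S2 S3 H1 H2 H3; rewrite poly_sizeX; lia.
have [t3 g3 m3] := der_exec (der_lin2 (der_mem L1) (der_mem L2) E le).
exists t3, (v :: C); split; last exact: m3.
- by apply: growW (grow_trans (grow_trans g1 g2) g3); rewrite mulSn; lia.
- by apply/bits_cons; lift g3.
- by rewrite /= sC.
Qed.

End Arithmetic.

Section Arithmetic2.
Variables (n : nat) (fs : seq (epoly n)).
Implicit Types (s t u : state fs) (p q r g h : epoly n) (a b v z : var n) (N K M W : nat).
Implicit Types (A B C P Q U : seq (var n)).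

Lemma binval_bound_ge W : (W + 3 <= binval_bound W)%N.
Proof. by rewrite /binval_bound; nia. Qed.

Lemma poly_sizeD_le p q N M : (poly_size p <= N)%N -> (poly_size q <= M)%N ->
  (poly_size (p + q) <= N + M)%N.
Proof. by move=> H1 H2; rewrite (leq_trans (poly_sizeD _ _)) // leq_add. Qed.

Lemma poly_sizeB_le p q N M : (poly_size p <= N)%N -> (poly_size q <= M)%N ->
  (poly_size (p - q) <= N + M)%N.
Proof. by move=> H1 H2; rewrite (leq_trans (poly_sizeB _ _)) // leq_add. Qed.

Lemma poly_sizeM_le p q N M : (poly_size p <= N)%N -> (poly_size q <= M)%N ->
  (poly_size (p * q) <= N * M)%N.
Proof. by move=> H1 H2; rewrite (leq_trans (poly_sizeM _ _)) // leq_mul. Qed.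

Lemma poly_size_X_le v : (poly_size (X v) <= 2)%N.
Proof. by rewrite poly_sizeX. Qed.

Lemma poly_sizeXM_le v q N : (poly_size q <= N)%N -> (poly_size (X v * q) <= N)%N.
Proof. exact: leq_trans (poly_sizeXM _ _). Qed.

Lemma exp2_malgC w : 2%:R ^+ w = ((2 ^+ w : int)%:MP : epoly n).
Proof. by rewrite -mpolyC_nat -rmorphXn. Qed.

Lemma csize_exp2 w : csize (2 ^+ w) = w.+2.
Proof. by rewrite /csize expf_eq0 andbF /bitsize abszX trunc_expnK. Qed.

Lemma poly_size_exp2 w : poly_size (2%:R ^+ w : epoly n) = w.+2.
Proof. by rewrite exp2_malgC poly_sizeC csize_exp2. Qed.

(** One row of the schoolbook multiplication. *)
Lemma and_bits W s z a Q : zerov s z -> (size Q <= W)%N -> bit s a -> bits s Q ->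
  exists t U, [/\ grow (size Q * (1000 + 2 * binval_bound W)) s t, bits t U, size U = size Q
    & binval U - X a * binval Q known_in t].
Proof.
move=> Zz; elim: Q s Zz => [|q Q IH] s Zz leW Ba /=.
  move=> _; have [t g m] := der_exec (der0 Zz).
  have E : binval [::] - X a * binval [::] = 0 by rewrite /=; poly_ring.
  by exists t, [::]; rewrite E.
move=> /bits_cons [Bq BQ].
have [t1 [v [g1 Bv L1]]] := and_gate Ba Bq; lift g1.
have [t2 [U [g2 BU sU L2]]] := IH t1 Zz (ltnW leW) Ba BQ; lift g2.
have E : (X v - X a * X q) + 2%:R * (binval U - X a * binval Q)
   = binval (v :: U) - X a * binval (q :: Q) by rewrite /=; poly_ring.
have le : (poly_size (binval (v :: U) - X a * binval (q :: Q)) <= 2 * binval_bound W)%N.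
  rewrite mul2n -addnn; apply: poly_sizeB_le; last apply: poly_sizeXM_le.
    by apply: poly_size_binval_le; rewrite /= sU leqW.
  by apply: poly_size_binval_le; rewrite /= leqW.
have [t3 g3 m3] := der_exec (der_lin2 (der_mem L1) (der_mem L2) E le).
exists t3, (v :: U); split; last exact: m3.
- by apply: growW (grow_trans (grow_trans g1 g2) g3); rewrite mulSn; lia.
- by apply/bits_cons; lift g3.
- by rewrite /= sU.
Qed.

Definition mac_cost W : nat := (W * (31 * 1000 + 2 + 5 * binval_bound W) + binval_bound W * binval_bound W + 12 * binval_bound W + 20)%N.

(* The low bit of A + p * Q is output and the rest is the new A: the width stays
   |P| + |Q| without an overflow argument. *)
Lemma mac_bits W s z A P Q : zerov s z -> size A = size Q -> (size P + size Q <= W)%N ->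
  bits s A -> bits s P -> bits s Q ->
  exists t C, [/\ grow (size P * mac_cost W) s t, bits t C, size C = (size P + size Q)%N
    & binval A + binval P * binval Q - binval C known_in t].
Proof.
elim: P A s => [|p P IH] A s Zz sz leW BA /=.
  move=> _ BQ; have [t g m] := der_exec (der0 Zz).
  have E : binval A + binval [::] * binval Q - binval A = 0 by rewrite /=; poly_ring.
  by exists t, A; rewrite E; split => //; lift g.
move=> /bits_cons [Bp BP] BQ.
have leQ : (size Q <= W)%N by apply: leq_trans leW; rewrite leq_addl.
have leA : (size A <= W)%N by rewrite sz.
have [t1 [U [g1 BU sU L1]]] := and_bits Zz leQ Bp BQ; lift g1.
have [|t2 [C' [g2 BC sC L2]]] := add_bits Zz _ leA BA BU Zz.1; first by rewrite sU.
lift g2; case: C' sC BC L2 => // v H [sH] /bits_cons [Bv BH] L2.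
have [||t3 [C [g3 BC sC L3]]] := IH H t2 Zz _ _ BH BP BQ; first by rewrite sH.
  exact: ltnW leW.
lift g3.
have NA : (poly_size (binval A) <= binval_bound W)%N by apply: poly_size_binval_le; rewrite leqW.
have NU : (poly_size (binval U) <= binval_bound W)%N by apply: poly_size_binval_le; rewrite sU leqW.
have NQ : (poly_size (binval Q) <= binval_bound W)%N by apply: poly_size_binval_le; rewrite leqW.
have NP : (poly_size (binval (p :: P)) <= binval_bound W)%N.
  by apply: poly_size_binval_le; rewrite /= leqW // (leq_trans _ leW) //= addSn ltnS leq_addr.
have NH : (poly_size (binval (v :: H)) <= binval_bound W)%N.
  by apply: poly_size_binval_le; rewrite /= sH ltnS.
have NC : (poly_size (binval (v :: C)) <= binval_bound W)%N.
  by apply: poly_size_binval_le; rewrite /= sC -addSn leqW.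
have D1 := der_line L1 (poly_sizeB_le NU (poly_sizeXM_le _ NQ)).
have D2 := der_line L2 (poly_sizeB_le (poly_sizeD_le (poly_sizeD_le NA NU) (poly_size_X_le z)) NH).
have D0 := der_line Zz.2 (poly_size_X_le z).
have E : (binval A + binval U + X z - binval (v :: H) - (binval U - X p * binval Q) - X z) +
    2%:R * (binval H + binval P * binval Q - binval C)
   = binval A + binval (p :: P) * binval Q - binval (v :: C) by rewrite /=; poly_ring.
have le := poly_sizeB_le (poly_sizeD_le NA (poly_sizeM_le NP NQ)) NC.
have [t4 g4 m4] := der_exec (der_lin2 (derB (derB D2 D1) D0) (der_mem L3) E le).
exists t4, (v :: C); split; last exact: m4.
- apply: growW (grow_trans (grow_trans (grow_trans g1 g2) g3) g4).
  have : (size Q * (1000 + 2 * binval_bound W) + size A * (30 * 1000 + 3 * binval_bound W + 2)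
     <= W * (31 * 1000 + 2 + 5 * binval_bound W))%N by rewrite sz -mulnDr leq_mul //; lia.
  have EM : mac_cost W = (W * (31 * 1000 + 2 + 5 * binval_bound W) + binval_bound W * binval_bound W + 12 * binval_bound W + 20)%N by [].
  move: EM; rewrite mulSn; move: (binval_bound W) (mac_cost W) => x y; nia.
- by apply/bits_cons; lift g4.
- by rewrite /= sC.
Qed.

Lemma one_gate s z : zerov s z -> exists t v, [/\ grow 1000 s t, bit t v & X v - 1 known_in t].
Proof.
move=> Zz; have DQ := der0 Zz; der_as DQ ((1 : epoly n) ^+ 2 - 1).
have [t [v [g B m]]] := gate (mulby1 fs _) DQ.
by exists t, v; split => //; apply: growW g.
Qed.

Lemma poly_size_nat k : poly_size (k%:R : epoly n) = csize k%:Z.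
Proof. by rewrite -mpolyC_nat poly_sizeC natz. Qed.

Lemma poly_size1 : (poly_size (1 : epoly n) <= 2)%N.
Proof. by rewrite (poly_size_nat 1). Qed.

Lemma csize_nat_le k w : (k < 2 ^ w)%N -> (csize k%:Z <= w + 1)%N.
Proof.
rewrite /csize; case: eqP => // k0; rewrite /bitsize /=; case: k k0 => // k _ lt.
have : (trunc_log 2 k.+1 < w)%N.
  by rewrite -(@ltn_exp2l 2) // (leq_ltn_trans _ lt) // trunc_logP.
lia.
Qed.

(** The digits are copies of [z] and [o], so that a constant requires no new variable. *)
Lemma der_num W s z o k w : zerov s z -> bit s o -> X o - 1 known_in s ->
  (w <= W)%N -> (k < 2 ^ w)%N ->
  exists C, [/\ bits s C, size C = w & der s (w * (2 * binval_bound W + 10)) (2 * binval_bound W) (binval C - k%:R)].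
Proof.
move=> Zz Bo Lo; elim: w k => [|w IH] k leW.
  rewrite expn0 => lt; have -> : k = 0%N by lia.
  exists [::]; split; [exact: bits_nil | by [] | ].
  have -> : binval [::] - 0%:R = 0 :> epoly n by exact: subr0.
  exact: derW (der0 Zz) (leq0n _) (leq0n _).
move=> lt; have lt2 : (k./2 < 2 ^ w)%N by move: lt; rewrite expnS; lia.
have [C [BC sC DC]] := IH _ (ltnW leW) lt2.
pose c := if odd k then o else z.
have Bc : bit s c by rewrite /c; case: ifP => _; [exact: Bo | exact: Zz.1].
have Dc : der s 10 4 (X c - (odd k)%:R).
  rewrite /c; case: ifP => _.
    exact: derW (der_line Lo (poly_sizeB_le (poly_size_X_le _) poly_size1)) (leq0n _) (leqnn _).
  rewrite subr0; exact: derW (der_line Zz.2 (poly_size_X_le _)) (leq0n _) (isT : 2 <= 4)%N.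
exists (c :: C); split; [by apply/bits_cons; split; [exact: Bc | exact: BC] | by rewrite /= sC | ].
have E : (X c - (odd k)%:R) + 2%:R * (binval C - k./2%:R) = binval (c :: C) - k%:R.
  rewrite -[in RHS](odd_double_half k) natrD -mul2n natrM /=; poly_ring.
apply: derW (der_lin2 Dc DC E (poly_sizeB_le _ _)) _ _.
- by apply: (poly_size_binval_le (W := W)); rewrite /= sC leqW.
- by rewrite poly_size_nat; apply: leq_trans (csize_nat_le lt) _; apply: leq_trans (binval_bound_ge W); lia.
- by rewrite mulSn; lia.
- by lia.
Qed.

Lemma not_bits W s z A : zerov s z -> (size A <= W)%N -> bits s A ->
  exists t B, [/\ grow (size A * (1000 + 4 * binval_bound W)) s t, bits t B, size B = size A
    & binval B + binval A + 1 - 2%:R ^+ size A known_in t].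
Proof.
elim: A s => [|a A IH] s Zz leW /=.
  move=> _; have [t g m] := der_exec (der0 Zz).
  have E : binval [::] + binval [::] + 1 - 2%:R ^+ 0 = 0 :> epoly n by rewrite /= expr0; poly_ring.
  by exists t, [::]; rewrite E.
move=> /bits_cons [Ba BA]; rewrite /= in leW.
have [t1 [v [g1 Bv L1]]] := not_gate Ba; lift g1.
have [t2 [B [g2 BB sB L2]]] := IH t1 Zz (ltnW leW) BA; lift g2.
have E : (X v - (1 - X a)) + 2%:R * (binval B + binval A + 1 - 2%:R ^+ size A)
   = binval (v :: B) + binval (a :: A) + 1 - 2%:R ^+ (size A).+1.
  by rewrite /= exprS; generalize (2%:R ^+ size A : epoly n); intro; poly_ring.
have le : (poly_size (binval (v :: B) + binval (a :: A) + 1 - 2%:R ^+ (size A).+1) <= 4 * binval_bound W)%N.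
  apply: leq_trans (poly_sizeB_le (poly_sizeD_le (poly_sizeD_le _ _) _) (leqnn _)) _.
  - by apply: (poly_size_binval_le (W := W)); rewrite /= sB leqW.
  - by apply: (poly_size_binval_le (W := W)); rewrite /= leqW.
  - exact: poly_size1.
  - rewrite poly_size_exp2; have := binval_bound_ge W; move: (binval_bound W) => x; lia.
have [t3 g3 m3] := der_exec (der_lin2 (der_mem L1) (der_mem L2) E le).
exists t3, (v :: B); split; last exact: m3.
- by apply: growW (grow_trans (grow_trans g1 g2) g3); rewrite mulSn; lia.
- by apply/bits_cons; lift g3.
- by rewrite /= sB.
Qed.

Lemma der_pad W s z A k : zerov s z -> (size A + k <= W)%N ->
  der s ((size A + k) * (2 * binval_bound W + 2)) (2 * binval_bound W) (binval (A ++ nseq k z) - binval A).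
Proof.
move=> Zz; have D0 := der_line Zz.2 (poly_size_X_le z).
elim: A => [|a A IH].
  rewrite add0n /= subr0; elim: k => [|k IH] leW.
    by apply: derW (der0 Zz) _ _.
  apply: derW (der_lin2 D0 (IH (ltnW leW)) (erefl _) _) _ _.
  - by apply: (poly_size_binval_le (W := W) (A := nseq k.+1 z)); rewrite size_nseq leqW.
  - by rewrite mulSn; lia.
  - by lia.
move=> leW; have D := IH (ltnW leW).
have E : 0 + 2%:R * (binval (A ++ nseq k z) - binval A) = binval ((a :: A) ++ nseq k z) - binval (a :: A).
  by rewrite /=; poly_ring.
apply: derW (der_lin2 (der0 Zz) D E (poly_sizeB_le _ _)) _ _.
- by apply: (poly_size_binval_le (W := W)); rewrite size_cat size_nseq leqW.
- by apply: (poly_size_binval_le (W := W)); rewrite leqW // (leq_trans _ leW) // leq_addr.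
- by rewrite [size (a :: A)]/= addSn mulSn; lia.
- by lia.
Qed.

Lemma bits_pad s z A k : zerov s z -> bits s A -> bits s (A ++ nseq k z).
Proof. by move=> Zz BA v; rewrite mem_cat mem_nseq => /orP[/BA //|/andP[_ /eqP ->]]; case: Zz. Qed.

End Arithmetic2.

(** * Arithmetic of signed numbers *)

Section RepOps.
Variables (n : nat) (fs : seq (epoly n)).
Implicit Types (s t u : state fs) (p q r g h : epoly n) (a b v z o : var n) (k w N K M W T : nat).
Implicit Types (A B C P Q U : seq (var n)).

Lemma size_rep_line W T w p P Q : (poly_size p <= T)%N -> size P = w -> size Q = w -> (w <= W)%N ->
  (poly_size (p - (binval P - binval Q)) <= T + (binval_bound W + binval_bound W))%N.
Proof.
move=> HT sP sQ le; apply: poly_sizeB_le => //.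
by apply: poly_sizeB_le; apply: poly_size_binval_le; rewrite ?sP ?sQ leqW.
Qed.

(** Widths are made equal before an addition, and raised to those prescribed by the circuit lengths
    after a product. *)
Lemma rep_pad W T s z o w w' p : base s z o -> rep s w p -> (poly_size p <= T)%N ->
  (w <= w')%N -> (w' <= W)%N ->
  exists2 t, grow (2 * (W * (2 * binval_bound W + 2)) + 2 * T + 14 * binval_bound W) s t & rep t w' p.
Proof.
move=> [Zz _ _] [P [Q [BP BQ sP sQ L]]] HT le1 le2.
have e1 : (w + (w' - w) = w')%N by rewrite subnKC.
have D0 := der_line L (size_rep_line HT sP sQ (leq_trans le1 le2)).
have [hP hQ] : (size P + (w' - w) <= W /\ size Q + (w' - w) <= W)%N by rewrite sP sQ e1.
have DP := der_pad Zz hP; have DQ := der_pad Zz hQ.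
have D := derD (derB D0 DP) DQ.
der_as D (p - (binval (P ++ nseq (w' - w) z) - binval (Q ++ nseq (w' - w) z))).
have [t g m] := der_exec D; exists t.
  apply: growW g; rewrite sP sQ e1; move: (binval_bound W) => y.
  have : (w' * (2 * y + 2) <= W * (2 * y + 2))%N by rewrite leq_mul.
  lia.
exists (P ++ nseq (w' - w) z), (Q ++ nseq (w' - w) z).
split; [| | | | exact: m]; try by rewrite size_cat size_nseq ?sP ?sQ.
  exact/(bits_grow g)/bits_pad.
exact/(bits_grow g)/bits_pad.
Qed.

Definition add_cost W T : nat := (2 * (W * (30 * 1000 + 3 * binval_bound W + 2)) + 6 * T + 40 * binval_bound W + 20)%N.

Lemma rep_add W T s z o w p q : base s z o -> rep s w p -> rep s w q ->
  (poly_size p <= T)%N -> (poly_size q <= T)%N -> (w < W)%N ->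
  exists2 t, grow (add_cost W T) s t & rep t w.+1 (p + q).
Proof.
move=> Bs [P1 [N1 [BP1 BN1 sP1 sN1 L1]]] [P2 [N2 [BP2 BN2 sP2 sN2 L2]]] Tp Tq ltw.
have lw := ltnW ltw.
have D1 := der_line L1 (size_rep_line Tp sP1 sN1 lw).
have D2 := der_line L2 (size_rep_line Tq sP2 sN2 lw).
have [Zz _ _] := Bs.
have [||t1 [P [g1 BP sP LP]]] := add_bits (W := W) Zz _ _ BP1 BP2 Zz.1; rewrite ?sP1 ?sP2 //.
lift g1.
have [||t2 [N [g2 BN sN LN]]] := add_bits (W := W) Zz _ _ BN1 BN2 Zz.1; rewrite ?sN1 ?sN2 //.
lift g2.
have ub A : (size A <= w.+1)%N -> (poly_size (binval A) <= binval_bound W)%N.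
  by move=> le; apply: poly_size_binval_le; apply: leq_trans le _; rewrite ltnS.
have sl A B C : (size A <= w.+1)%N -> (size B <= w.+1)%N -> (size C <= w.+1)%N ->
    (poly_size (binval A + binval B + X z - binval C)%R <= binval_bound W + binval_bound W + 2 + binval_bound W)%N.
  move=> hA hB hC; apply: poly_sizeB_le (ub _ hC).
  exact: poly_sizeD_le (poly_sizeD_le (ub _ hA) (ub _ hB)) (poly_size_X_le z).
have DP : der t2 0 _ _ := der_line LP (sl _ _ _ _ _ _).
have {}DP := DP ltac:(by rewrite sP1) ltac:(by rewrite sP2) ltac:(by rewrite sP sP1).
have DN : der t2 0 _ _ := der_line LN (sl _ _ _ _ _ _).
have {}DN := DN ltac:(by rewrite sN1) ltac:(by rewrite sN2) ltac:(by rewrite sN sN1).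
have D := derB (derD (derD D1 D2) DP) DN.
der_as D (p + q - (binval P - binval N)).
have [t3 g3 m] := der_exec D; lift g3; exists t3.
  apply: growW (grow_trans (grow_trans g1 g2) g3); rewrite sP1 sN1 /add_cost; move: (binval_bound W) => y.
  have : (w * (30 * 1000 + 3 * y + 2) <= W * (30 * 1000 + 3 * y + 2))%N by rewrite leq_mul.
  lia.
by exists P, N; split; [exact: BP | exact: BN | rewrite sP sP1 | rewrite sN sN1 | exact: m].
Qed.

(** Proved directly by induction: composing [mulbyD] with multiplication by 2 would multiply the
    size bound by 3 at every bit. *)
Lemma mulby_binval W k A : all (vbelow k) A -> (size A <= W)%N ->
  mulby fs k (binval_bound W) (size A * (binval_bound W + 1)) (binval A).
Proof.
elim: A => [|a A IH].
  move=> _ _; have -> : binval [::] = 0%:MP :> epoly n by rewrite malgC0E.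
  exact: mulbyW (mulbyC fs k 0) (leqnn _) (leq0n _) (leq0n _).
rewrite [all _ _]/= => /andP [va vA] leW.
have [B _ H] := IH vA (ltnW leW).
have ub := @poly_size_binval_le n W (a :: A) (leqW leW).
split; [| exact: ub |].
  apply: belowD; first exact: belowX.
  by apply: belowM => //; apply: below_nat.
move=> s M p ks m le.
have D1 := der_XM (vbelowW ks va) (der_line m le).
have D2 := H s M p ks m le.
have E : X a * p + 2%:R * (binval A * p) = binval (a :: A) * p by rewrite /=; poly_ring.
apply: derW (der_lin2 D1 D2 E (poly_sizeM_le ub le)) _ (leqnn _).
change (size (a :: A)) with (size A).+1; move: (binval_bound W) (size A); clear; move=> x y; lia.
Qed.

Lemma bits_vbelow s A : bits s A -> all (vbelow (size (exts s))) A.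
Proof. by move=> H; apply/allP => v /H []. Qed.

Lemma mulby_bits W s A : bits s A -> (size A <= W)%N ->
  mulby fs (size (exts s)) (binval_bound W) (W * (binval_bound W + 1)) (binval A).
Proof.
move=> BA leW; apply: mulbyW (mulby_binval (bits_vbelow BA) leW) (leqnn _) (leqnn _) _.
by rewrite leq_mul.
Qed.

Definition mul_cost W T : nat := (4 * (W * mac_cost W) + 2 * (W * (30 * 1000 + 3 * binval_bound W + 2)) +
   1000 * (T + binval_bound W + 1) * (binval_bound W + 1) * (W + 1))%N.

(** The positive part is $P_1 P_2 + N_1 N_2$ and the negative part $P_1 N_2 + N_1 P_2$. The
    asymmetry between [p] and [q] comes from the use: monomials are built by one variable at a time,
    and only that factor has to be a cheap multiplier. *)
Lemma rep_mul W T s z o w1 w2 p q : base s z o -> rep s w1 p -> rep s w2 q ->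
  (poly_size p <= T)%N -> mulby fs (size (exts s)) 2 4 q -> (w1 + w2 < W)%N ->
  exists2 t, grow (mul_cost W T) s t & rep t (w1 + w2).+1 (p * q).
Proof.
move=> Bs [P1 [N1 [BP1 BN1 sP1 sN1 L1]]] [P2 [N2 [BP2 BN2 sP2 sN2 L2]]] Tp mq ltw.
have lw := ltnW ltw.
have lw1 : (w1 <= W)%N := leq_trans (leq_addr _ _) lw.
have lw2 : (w2 <= W)%N := leq_trans (leq_addl _ _) lw.
have [_ Tq _] := mq.
have D1 := der_line L1 (size_rep_line Tp sP1 sN1 lw1).
have D2 := der_line L2 (size_rep_line Tq sP2 sN2 lw2).
have [Zz _ _] := Bs.
pose Z := nseq w2 z; have BZ : bits s Z.
  by move=> v; rewrite mem_nseq => /andP[_ /eqP ->]; case: Zz.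
have sZ : size Z = w2 by rewrite size_nseq.
have mP1 : (size P1 <= W)%N by rewrite sP1.
have mN1 : (size N1 <= W)%N by rewrite sN1.
have mV := mulbyD (mulby_bits BP1 mP1) (mulbyN (mulby_bits BN1 mN1)).
(* With $V_i = P_i - N_i$ this is $q (p - V_1) + V_1 (q - V_2) = pq - V_1 V_2$. *)
have D0 := derD (der_mul mq (leqnn _) D1) (der_mul mV (leqnn _) D2).
move: D0; clear D1 D2 mV mq => D0.
have mac P Q (u : state fs) : zerov u z -> bits u Z -> bits u P -> bits u Q -> size P = w1 -> size Q = w2 ->
    exists t C, [/\ grow (W * mac_cost W) u t, bits t C, size C = (w1 + w2)%N
    & der t 0 (binval_bound W + binval_bound W * binval_bound W + binval_bound W) (binval Z + binval P * binval Q - binval C)].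
  move=> Zu bZ bP bQ sP sQ.
  have [||t [C [g BC sC L]]] := mac_bits (W := W) Zu _ _ bZ bP bQ; rewrite ?sP ?sQ //.
  exists t, C; split; [| exact: BC | by rewrite sC sP sQ |].
    by apply: growW g; rewrite sP leq_mul.
  apply: der_line L _; apply: poly_sizeB_le (poly_sizeD_le _ (poly_sizeM_le _ _)) _;
    by apply: poly_size_binval_le; rewrite ?sZ ?sP ?sQ ?sC ?sP ?sQ leqW.
have add P Q (u : state fs) : zerov u z -> bits u P -> bits u Q -> size P = (w1 + w2)%N -> size Q = (w1 + w2)%N ->
    exists t C, [/\ grow (W * (30 * 1000 + 3 * binval_bound W + 2)) u t, bits t C, size C = (w1 + w2).+1
    & der t 0 (binval_bound W + binval_bound W + 2 + binval_bound W) (binval P + binval Q + X z - binval C)].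
  move=> Zu bP bQ sP sQ.
  have [||t [C [g BC sC L]]] := add_bits (W := W) Zu _ _ bP bQ Zu.1; rewrite ?sP ?sQ //.
  exists t, C; split; [| exact: BC | by rewrite sC sP |].
    by apply: growW g; rewrite sP leq_mul.
  apply: der_line L _; apply: poly_sizeB_le (poly_sizeD_le (poly_sizeD_le _ _) (poly_size_X_le z)) _;
    by apply: poly_size_binval_le; rewrite ?sP ?sQ ?sC ?sP leqW // ltnW.
have [t1 [C1 [g1 BC1 sC1 M1]]] := mac _ _ _ Zz BZ BP1 BP2 sP1 sP2; lift g1.
have [t2 [C2 [g2 BC2 sC2 M2]]] := mac _ _ _ Zz BZ BN1 BN2 sN1 sN2; lift g2.
have [t3 [C3 [g3 BC3 sC3 M3]]] := mac _ _ _ Zz BZ BP1 BN2 sP1 sN2; lift g3.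
have [t4 [C4 [g4 BC4 sC4 M4]]] := mac _ _ _ Zz BZ BN1 BP2 sN1 sP2; lift g4.
have [t5 [P [g5 BP sP A1]]] := add _ _ _ Zz BC1 BC2 sC1 sC2; lift g5.
have [t6 [N [g6 BN sN A2]]] := add _ _ _ Zz BC3 BC4 sC3 sC4; lift g6.
have D := derD (derD D0 (derB (derB (derD M1 M2) M3) M4)) (derB A1 A2).
der_as D (p * q - (binval P - binval N)).
have [t7 g7 m] := der_exec D; lift g7; exists t7.
  apply: growW (grow_trans (grow_trans (grow_trans (grow_trans (grow_trans (grow_trans g1 g2) g3) g4) g5) g6) g7).
  rewrite /mul_cost; move: (mac_cost W) (binval_bound W) => x y; clear.
  nia.
by exists P, N; split; [exact: BP | exact: BN | exact: sP | exact: sN | exact: m].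
Qed.
End RepOps.

Ltac gen_size :=
  repeat match goal with |- context [poly_size ?p] => generalize (poly_size p); intro end.

(** * Elimination of the square root rule *)

(* [c] and [k] are left as evars, which [bnd_tac] instantiates. *)
Definition bnd (U c k x : nat) : Prop := (x <= c * U ^ k)%N.

Lemma bnd_leq U c k x y : (x <= y)%N -> bnd U c k y -> bnd U c k x.
Proof. exact: leq_trans. Qed.

Lemma bnd_const U c : bnd U c 0 c.
Proof. by rewrite /bnd expn0 muln1. Qed.

Lemma bnd_id U : bnd U 1 1 U.
Proof. by rewrite /bnd expn1 mul1n. Qed.

(** Adding the exponents is wasteful, but it lets both be evars when the lemma is applied; only the
    existence of a polynomial bound matters. *)
Lemma bndD U c d k l x y : (0 < U)%N -> bnd U c k x -> bnd U d l y ->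
  bnd U (c + d) (k + l) (x + y).
Proof.
move=> U0 Hx Hy; rewrite /bnd mulnDl leq_add //.
  by apply: leq_trans Hx _; rewrite leq_mul // leq_pexp2l // leq_addr.
by apply: leq_trans Hy _; rewrite leq_mul // leq_pexp2l // leq_addl.
Qed.

Lemma bndM U c d k l x y : bnd U c k x -> bnd U d l y -> bnd U (c * d) (k + l) (x * y).
Proof. by move=> Hx Hy; rewrite /bnd expnD mulnACA leq_mul. Qed.

Lemma bndS U c k x : (0 < U)%N -> bnd U c k x -> bnd U (c + 1) k x.+1.
Proof.
move=> U0 Hx; rewrite /bnd mulnDl mul1n -addn1 leq_add //.
by rewrite expn_gt0 U0.
Qed.

Lemma bndX U c k x e : bnd U c k x -> bnd U (c ^ e) (k * e) (x ^ e).
Proof. by move=> Hx; rewrite /bnd expnM -expnMn; case: e => [|e] //; rewrite leq_exp2r. Qed.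

Ltac bnd_tac := lazymatch goal with
  | |- bnd ?U _ _ ?U => exact: bnd_id
  | |- bnd _ _ _ (addn _ _) => apply: bndD; [by [] | bnd_tac | bnd_tac]
  | |- bnd _ _ _ (muln _ _) => apply: bndM; [bnd_tac | bnd_tac]
  | |- bnd _ _ _ (expn _ _) => apply: bndX; bnd_tac
  | H : is_true (leq ?x ?y) |- bnd _ _ _ ?x => apply: (bnd_leq H); clear H; bnd_tac
  | |- _ => first [exact: bnd_const | apply: bndS; [by [] | bnd_tac]]
  end.

Section Sqrt.
Variables (n : nat) (fs : seq (epoly n)).
Implicit Types (s t u : state fs) (p q r g h : epoly n) (a b v z o : var n) (k w N K M W T : nat).
Implicit Types (A B C P Q U : seq (var n)).

Lemma mpolyC_int k : ((k%:Z)%:MP : epoly n) = k%:R.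
Proof. by rewrite -mpolyC_nat natz. Qed.

Lemma der_ebvp_nat s c N g k A : (0 < k)%N -> (0 < size A)%N ->
  bits s A -> poly_below (size (exts s)) g ->
  der s c N (g * (k%:R + binval A)) -> der s (c + poly_size g) (poly_size g) g.
Proof.
move=> k0 A0 BA Bg; rewrite -mpolyC_int; apply: der_ebvp => //.
Qed.

Definition const_cost W : nat := (4 * (W * (2 * binval_bound W + 10)) + 20 * binval_bound W)%N.

Lemma rep_const W s z o w (c : int) : base s z o -> (w <= W)%N -> (absz c < 2 ^ w)%N ->
  exists2 t, grow (const_cost W) s t & rep t w c%:MP.
Proof.
move=> [Zz Bo Lo] leW lt.
have [C [BC sC DC]] := der_num Zz Bo Lo leW lt.
have [C0 [BC0 sC0 DC0]] := der_num (k := 0) Zz Bo Lo leW (expn_gt0 2 w).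
have [ge|le] := leP 0 c.
  have D := derB DC0 DC; der_as D ((absz c)%:R - (binval C - binval C0)).
  have [t g m] := der_exec D; lift g; exists t.
    apply: growW g; rewrite /const_cost.
    have : (w * (2 * binval_bound W + 10) <= W * (2 * binval_bound W + 10))%N by rewrite leq_mul.
    move: (binval_bound W) => y; lia.
  exists C, C0; split; [exact: BC | exact: BC0 | exact: sC | exact: sC0 |].
  have -> : (c%:MP : epoly n) = (absz c)%:R; last exact: m.
  by rewrite -mpolyC_int gez0_abs.
have D := derB DC DC0; der_as D (- (absz c)%:R - (binval C0 - binval C)).
have [t g m] := der_exec D; lift g; exists t.
  apply: growW g; rewrite /const_cost.
  have : (w * (2 * binval_bound W + 10) <= W * (2 * binval_bound W + 10))%N by rewrite leq_mul.
  move: (binval_bound W) => y; lia.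
exists C0, C; split; [exact: BC0 | exact: BC | exact: sC0 | exact: sC |].
have -> : (c%:MP : epoly n) = - (absz c)%:R; last exact: m.
have {1}-> : c = - (absz c)%:Z by rewrite ltz0_abs // opprK.
by rewrite monalgUN mpolyC_int.
Qed.

Lemma binval_rcons A a : binval (rcons A a) = binval A + 2%:R ^+ size A * X a.
Proof.
elim: A => [|b A IH] /=; first by rewrite /binval /= expr0 mul1r mulr0 addr0 add0r.
by rewrite IH exprS; generalize (2%:R ^+ size A : epoly n); intro; poly_ring.
Qed.

End Sqrt.

Lemma leq_add_mid a b S Q : (a + b <= Q)%N -> (a + S + b <= Q + S)%N.
Proof. lia. Qed.

Lemma sq_bits : exists c k, forall U W, (W < U)%N ->
  forall n (fs : seq (epoly n)) (s : state fs) z o A, base s z o -> (size A < W)%N -> bits s A ->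
  binval A * binval A known_in s ->
  exists2 t, grow (size A * (c * U ^ k)) s t & binval A known_in t.
Proof.
(* The constants must not depend on the system or on the number. They are left open here and read
   off, at the very end, from the cost of treating one bit. *)
eexists; eexists => U W WU n fs s z o A.
elim: A s => [|a A IH] s Bs leW.
  by move=> _ _; case: Bs => Zz _ _; have [t g m] := der_exec (der0 Zz); exists t.
move=> BaA; have /bits_cons [Ba BA] := BaA; move=> L.
have [Zz _ _] := Bs; have [Bz Lz] := Zz.
have ub := @poly_size_binval_le n W (a :: A) (ltnW (leqW leW)).
have DL := der_line L (poly_sizeM_le ub ub).
have leA : (size A <= W)%N by apply: ltnW; apply: ltnW.
have mA := mulby_bits BA leA.
have ma := bit_mulby Ba; have mz := bit_mulby Bz.
have m1 := mulby1 fs (size (exts s)); have m4 := mulby4 fs (size (exts s)).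
have m2 := mulby2 fs (size (exts s)).
(* With $E$ the value of [A], the list [z :: A] denotes $2E$ up to [z], so that $1 + 2E$ takes the
   form required by eBVP. *)
have BzA : bits s (z :: A) by apply/bits_cons; split; [exact: Bz | exact: BA].
have mF := mulbyD (mulby1 fs _) (mulby_bits BzA (ltnW leW)).
have mX := mulbyD (mulbyD ma m1) (mulbyM m4 mA).
have mY := mulbyM ma (mulbyD (mulbyD m2 (mulbyM m4 mA)) mz).
(* Since $a (a + 2E)^2 - (a + 1 + 4E)(a^2 - a) = a (1 + 2E)^2$, the bit equation of $a$ suffices;
   the multiple of [z] turns $1 + 2E$ into $1 + z + 2E$. *)
have D1 := derD (derB (der_mul ma (leqnn _) DL) (der_mul mX (leqnn _) (bit_der Ba)))
  (der_mul mY (leqnn _) (der_line Lz (poly_size_X_le z))).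
der_as D1 (X a * (1%:R + binval (z :: A)) * (1%:R + binval (z :: A))).
have [Ba1 Sg1 _] := mulbyM ma mF.
have D2 := der_ebvp_nat (isT : 0 < 1)%N (isT : 0 < size (z :: A))%N BzA Ba1 D1.
have [Ba2 Sa _] := ma.
have D3 := der_ebvp_nat (isT : 0 < 1)%N (isT : 0 < size (z :: A))%N BzA Ba2 D2.
have mG := mulbyD ma (mulbyM m4 mA).
have D4 := derB DL (der_mul mG (leqnn _) D3).
der_as D4 (4%:R * (binval A * binval A)).
have mAA := mulbyM mA mA; have [BAA SAA _] := mAA.
have D5 := derD D4 (der_mul mAA (leqnn _) (der_line Lz (poly_size_X_le z))).
(* eBVP requires at least one bit, so the constant 4 is taken as $4 + z$. *)
have Bz1 : bits s [:: z] by apply/bits_cons; split; [exact: Bz | exact: bits_nil].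
have ez : binval [:: z] = X z by rewrite /binval /= mulr0 addr0.
der_as D5 (binval A * binval A * (4%:R + X z)); rewrite -ez in D5.
have D6 := der_ebvp_nat (isT : 0 < 4)%N (isT : 0 < size [:: z])%N Bz1 BAA D5.
have [t1 g1 L1] := der_exec D6; lift g1.
have [t2 g2 L2] := IH t1 Bs (ltnW leW) BA L1; lift g2.
have E : X a + 2%:R * binval A = binval (a :: A) by [].
have [t3 g3 L3] := der_exec (der_lin2 D3 (der_mem L2) E ub).
exists t3; last exact: L3.
apply: growW (grow_trans (grow_trans g1 g2) g3).
change (size (a :: A)) with (size A).+1.
rewrite (mulSn (size A)) poly_sizeX; apply: leq_add_mid.
move: Sg1 SAA; gen_size; rewrite /binval_bound => Sg1 SAA; clear - U WU Sg1 SAA.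
have U0 : (0 < U)%N by exact: leq_ltn_trans WU.
have WU' := ltnW WU.
rewrite -/(bnd U _ _ _); bnd_tac.
Qed.

Lemma sqrt_elim : exists c d, forall U W T K, (W < U)%N -> (T <= U)%N -> (K <= U)%N ->
  forall n (fs : seq (epoly n)) k (s : state fs) z o w r, base s z o -> rep s w r -> (0 < w)%N -> (w < W)%N ->
  mulby fs k T K r -> (k <= size (exts s))%N -> r ^+ 2 known_in s ->
  exists2 t, grow (c * U ^ d) s t & r known_in t.
Proof.
have [c0 [d0 sq_bits]] := sq_bits.
eexists; eexists => U W T K WU TU KU n fs k s z o w r.
move=> Bs [P [N [BP BN sP sN Lp]]] w0 ltw mr0 ks Lr.
have [_ Tr _] := mr0.
have leW := ltnW ltw.
have lP : (size P <= W)%N by rewrite sP.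
have lN : (size N <= W)%N by rewrite sN.
have Dp0 := der_line Lp (size_rep_line Tr sP sN leW).
have [Zz _ _] := Bs.
have [t1 [N' [g1 BN' sN' Lb]]] := not_bits Zz lN BN; lift g1.
have [||t2 [C [g2 BC sC Lc]]] := add_bits (W := W) Zz _ _ BP BN' Zz.1; rewrite ?sP ?sN' ?sN //.
(* The sum of [P] and the complement of [N] has $w + 1$ bits; the top one is the carry [e], the
   others form [D]. *)
lift g2; case/lastP: C sC BC Lc => // D e; rewrite size_rcons sP => -[sD] BDe Lc.
have Be : bit t2 e by apply: BDe; rewrite mem_rcons mem_head.
have BD : bits t2 D by move=> v vD; apply: BDe; rewrite mem_rcons in_cons vD orbT.
have lD : (size D <= W)%N by rewrite sD.
have [t3 [D' [g3 BD' sD' Ld]]] := not_bits Zz lD BD; lift g3.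
clear BDe; move: Lb Lc Ld; rewrite binval_rcons sD sN => Lb Lc Ld.
have ub (A : seq (var n)) : (size A <= W)%N -> (poly_size (binval A) <= binval_bound W)%N.
  by move=> le; apply: poly_size_binval_le; apply: leqW.
pose p2 : epoly n := 2%:R ^+ w.
have mp2 j : mulby fs j (W + 2) (W + 2) p2.
  rewrite /p2 exp2_malgC; apply: mulbyW (mulbyC fs _ _) (leqnn _) _ _; rewrite csize_exp2; lia.
have [_ S2 _] := mp2 0%N.
have Db := der_line Lb (poly_sizeB_le (poly_sizeD_le (poly_sizeD_le (ub N' ltac:(by rewrite sN' sN)) (ub N ltac:(by rewrite sN))) (poly_size1 n)) S2).
have Dd := der_line Ld (poly_sizeB_le (poly_sizeD_le (poly_sizeD_le (ub D' ltac:(by rewrite sD' sD)) (ub D ltac:(by rewrite sD))) (poly_size1 n)) S2).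
have Dc := der_line Lc (poly_sizeB_le (poly_sizeD_le (poly_sizeD_le (ub P ltac:(by rewrite sP)) (ub N' ltac:(by rewrite sN' sN))) (poly_size_X_le z))
   (poly_sizeD_le (ub D ltac:(by rewrite sD)) (poly_sizeM_le S2 (poly_size_X_le e)))).
have Dr := der_line Lr (poly_sizeM_le Tr Tr).
have {}ks := leq_trans (leq_trans (leq_trans ks (grow_size g1)) (grow_size g2)) (grow_size g3).
have me := bit_mulby Be.
have mD := mulby_bits BD lD.
have mD' := mulby_bits (W := W) BD' ltac:(by rewrite sD' sD).
have mr := mulbyW mr0 ks (leqnn _) (leqnn _).
have Dz := der_line Zz.2 (poly_size_X_le z).
(* From here on $2^w$ is an atom: the identities below hold for any value of it, and only its cost
   as a multiplier matters. *)
move: Db Dc Dd; rewrite -/p2; move: p2 mp2 S2 => p2 mp2 S2 Db Dc Dd.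
have DL := derB (derB (derD Dp0 Dc) Db) Dz.
der_as DL (r - (binval D + p2 * X e - p2 + 1)).
(* Multiplied by $e$, the terms $2^w e - 2^w$ become $2^w (e^2 - e)$, which the bit equation of $e$
   removes. *)
have DL2 := derD (der_mul me (leqnn _) DL) (der_mul (mp2 _) (leqnn _) (bit_der Be)).
der_as DL2 (X e * r - X e * (1%:R + binval D)).
have m1 := mulby1 fs (size (exts t3)).
have mF := mulbyD m1 mD.
(* $e (1 + D)^2 = e r^2 - (r + 1 + D)(e r - e (1 + D))$. *)
have D1 := derB (derB (der_mul me (leqnn _) Dr) (der_mul mr (leqnn _) DL2)) (der_mul mF (leqnn _) DL2).
der_as D1 (X e * (1%:R + binval D) * (1%:R + binval D)).
have [B1 S1 _] := mulbyM me mF.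
have D0 : (0 < size D)%N by rewrite sD.
have D2 := der_ebvp_nat (isT : 0 < 1)%N D0 BD B1 D1.
have [Be1 Se _] := me.
have D3 := der_ebvp_nat (isT : 0 < 1)%N D0 BD Be1 D2.
have D4 := derD (derD DL (der_mul (mp2 _) (leqnn _) D3)) Dd.
der_as D4 (r + binval D').
(* $D'^2 = r^2 - (r - D')(r + D')$. *)
have D5 := derB Dr (der_mul (mulbyD mr (mulbyN mD')) (leqnn _) D4).
der_as D5 (binval D' * binval D').
have [t4 g4 L5] := der_exec D5; lift g4.
have lD' : (size D' < W)%N by rewrite sD' sD.
have [t5 g5 L6] := sq_bits _ _ WU _ _ _ _ _ _ Bs lD' BD' L5.
lift g5.
have D6 := derB D4 (der_line L6 (ub D' ltac:(by rewrite sD' sD))).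
der_as D6 r.
have [t6 g6 L7] := der_exec D6.
exists t6; last exact: L7.
apply: growW (grow_trans (grow_trans (grow_trans (grow_trans (grow_trans g1 g2) g3) g4) g5) g6).
rewrite sN sP sD sD' sD.
rewrite poly_sizeX; clear - U S1 WU TU KU leW.
have U0 : (0 < U)%N by exact: leq_ltn_trans WU.
have WU' := ltnW WU.
move: S1; gen_size; rewrite /binval_bound => S1.
rewrite -/(bnd U _ _ _); bnd_tac.
Qed.

(** * Circuits and their lengths *)

Section Circuits.
Variable n : nat.
Implicit Types (p q : epoly n) (v : var n) (m : {cmonom (var n)}).

(** Substituted circuits enter a length only through their own lengths, so an extension variable can
    stay a leaf weighted by the length of its circuit. *)
Fixpoint clenv (V : Type) (l : V -> nat) (C : circuit V) : nat :=
  match C with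
  | CVar v => l v
  | CConst c => up_log 2 (absz c)
  | CAdd A B => (maxn (clenv l A) (clenv l B)).+1
  | CMul A B => (clenv l A + clenv l B + 3)%N
  end.

Lemma clenv_subst (V W : Type) (f : V -> circuit W) C :
  circuit_length (circuit_subst f C) = clenv (fun x => circuit_length (f x)) C.
Proof. by elim: C => //= A -> B ->. Qed.

Definition mvars m : seq (var n) := flatten [seq nseq (m v) v | v <- enum_fset (finsupp m)].

Definition mcirc (c : int) (vs : seq (var n)) : circuit (var n) :=
  circuit_fold (@CMul _) (CConst _ 1)
    (if c == 1 then map (@CVar _) vs else CConst _ c :: map (@CVar _) vs).

Lemma monomial_circuitE c m : monomial_circuit c m = mcirc c (mvars m).
Proof.
rewrite /monomial_circuit /mcirc /mvars map_flatten -map_comp.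
by under [X in _ = circuit_fold _ _ (if _ then flatten X else _ :: flatten X)]eq_map
  do rewrite /= map_nseq.
Qed.

Variable l : var n -> nat.

Lemma clenv_foldl_add C s :
  (clenv l C + size s <= clenv l (foldl (@CAdd _) C s))%N /\
  forall D, List.In D s -> (clenv l D <= clenv l (foldl (@CAdd _) C s))%N.
Proof.
elim: s C => [|D s IH] C /=; first by rewrite addn0.
have [H1 H2] := IH (CAdd C D); rewrite /= in H1; split; first lia.
by move=> E [<-|/H2 //]; lia.
Qed.

Lemma clenv_foldl_mul C vs :
  clenv l (foldl (@CMul _) C (map (@CVar _) vs)) = (clenv l C + \sum_(v <- vs) (l v + 3))%N.
Proof.
elim: vs C => [|v vs IH] C /=; first by rewrite big_nil addn0.
by rewrite IH /= big_cons; lia.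
Qed.

(** Each product gate adds at least 3. The slack of 1 is for a single extension variable of length 0
    with coefficient 1, whose circuit has no gate. *)
Lemma mcirc_bounds c vs : [/\ (size vs <= clenv l (mcirc c vs) + 1)%N,
  (forall v, v \in vs -> (l v <= clenv l (mcirc c vs))%N)
  & (absz c <= 2 ^ clenv l (mcirc c vs))%N].
Proof.
have H us : (size us <= \sum_(v <- us) (l v + 3))%N /\
    forall v, v \in us -> (l v <= \sum_(v <- us) (l v + 3))%N.
  elim: us => [|u us [IH1 IH2]]; first by rewrite big_nil.
  rewrite big_cons /=; split; first lia.
  by move=> v; rewrite in_cons => /orP[/eqP ->|/IH2]; lia.
rewrite /mcirc; have [->|c1] := eqVneq c 1.
  case: vs => [|v vs]; first by split.
  rewrite /= clenv_foldl_mul /=; have [H1 H2] := H vs; split; first lia.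
    by move=> u; rewrite in_cons => /orP[/eqP ->|/H2]; lia.
  by rewrite expn_gt0.
rewrite [circuit_fold _ _ _]/= clenv_foldl_mul [clenv _ (CConst _ _)]/=.
have [H1 H2] := H vs; split; [lia | by move=> u /H2; lia |].
rewrite expnD; apply: leq_trans (_ : 2 ^ up_log 2 (absz c) <= _)%N.
  exact: up_logP.
by rewrite leq_pmulr // expn_gt0.
Qed.

Lemma In_map_mem (T : eqType) (V : Type) (f : T -> V) x s :
  x \in s -> List.In (f x) (map f s).
Proof. by elim: s => //= y s IH; rewrite in_cons => /orP[/eqP ->|/IH]; [left|right]. Qed.

Definition plen p := clenv l (poly_circuit p).

(** The monomials are added along a chain, so each further one raises the length by at least 1. A
    balanced sum would not bound their number linearly. *)
Lemma poly_circuit_bounds p : (size (msupp p) <= plen p + 1)%N /\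
  forall m, m \in msupp p -> (clenv l (mcirc p@_m (mvars m)) <= plen p)%N.
Proof.
rewrite /plen /poly_circuit.
have : forall m, m \in enum_fset (msupp p) ->
    List.In (mcirc p@_m (mvars m)) [seq monomial_circuit p@_m m | m <- enum_fset (msupp p)].
  by move=> m mp; rewrite -monomial_circuitE; apply: (In_map_mem (fun m => monomial_circuit p@_m m)).
rewrite -[size (msupp p)](size_map (fun m => monomial_circuit p@_m m)).
case: (map _ _) => [|C s] H /=; first by split => // m /H.
have [H1 H2] := clenv_foldl_add C s; split; first lia.
by move=> m /H [<-|/H2 //]; lia.
Qed.

Lemma poly_size_plen p : (poly_size p <= (plen p + 1) * (plen p + 2))%N.
Proof.
have [H1 H2] := poly_circuit_bounds p.
rewrite /poly_size.
have : (\sum_(m <- msupp p) bitsize p@_m <= \sum_(m <- msupp p) (plen p + 2))%N.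
  rewrite big_seq [leqRHS]big_seq; apply: leq_sum => m mp.
  have [_ _ H3] := mcirc_bounds p@_m (mvars m).
  have c0 : (0 < absz (p@_m))%N by rewrite absz_gt0 mcoeff_neq0.
  have : (2 ^ trunc_log 2 (absz p@_m) <= 2 ^ plen p)%N.
    apply: leq_trans (trunc_logP _ c0) (leq_trans H3 _) => //.
    by rewrite leq_exp2l // H2.
  by rewrite leq_exp2l // /bitsize; lia.
move/leq_trans; apply; rewrite big_const_seq count_predT iter_addn_0 mulnC.
by rewrite leq_mul2r H1 orbT.
Qed.

End Circuits.

(** * Substitution of polynomials for variables *)

Section Phi.
Variables (n : nat) (e : var n -> epoly n).
Implicit Types (p q : epoly n) (v : var n) (m : {cmonom (var n)}).

Definition mon_eval m : epoly n := \prod_(v <- finsupp m) e v ^+ m v.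

Lemma mon_evalEw m (d : {fset var n}) : (finsupp m `<=` d)%fset ->
  mon_eval m = \prod_(v <- d) e v ^+ m v.
Proof.
move=> le; rewrite /mon_eval; apply: big_fset_incl le _ => v _.
by rewrite -cmE_eq0 => /eqP ->; rewrite expr0.
Qed.

Lemma mon_eval_is_mmorphism : mmorphism mon_eval.
Proof.
split=> [m1 m2|]; last by rewrite /mon_eval mdom1 big_seq_fset0.
rewrite (mon_evalEw (fsubsetUl (finsupp m1) (finsupp m2))).
rewrite (mon_evalEw (fsubsetUr (finsupp m1) (finsupp m2))).
rewrite {1}/mon_eval mdomD -big_split /=; apply: eq_bigr => v _.
by rewrite cmM exprD.
Qed.

HB.instance Definition _ := monalg.isMultiplicative.Build _ _ mon_eval mon_eval_is_mmorphism.

Definition phi p : epoly n := mmap (@malgC {cmonom (var n)} int) mon_eval p.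

Lemma phiD p q : phi (p + q) = phi p + phi q. Proof. exact: mmapD. Qed.
Lemma phiB p q : phi (p - q) = phi p - phi q. Proof. exact: mmapB. Qed.
Lemma phiM p q : phi (p * q) = phi p * phi q.
Proof. by case: (@mmap_is_multiplicative _ _ _ (@malgC {cmonom (var n)} int) mon_eval) => H _; apply: H. Qed.
Lemma phi0 : phi 0 = 0. Proof. exact: mmap0. Qed.
Lemma phiC c : phi (c%:MP) = c%:MP. Proof. exact: mmapC. Qed.
Lemma phiZ c p : phi (c *: p) = c *: phi p.
Proof. by rewrite -!mul_malgC phiM phiC. Qed.

Lemma phi_lin a b p q : phi (a *: p + b *: q) = a *: phi p + b *: phi q.
Proof. exact: etrans (phiD _ _) (congr2 +%R (phiZ a p) (phiZ b q)). Qed.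
Lemma phiN p : phi (- p) = - phi p. Proof. exact: mmapN. Qed.
Lemma phi1 : phi 1 = 1. Proof. by rewrite -mpolyC1E phiC. Qed.

Lemma phiX v : phi (X v) = e v.
Proof.
rewrite /phi /X mmapU.
have -> : mon_eval (ucm v) = e v by rewrite /mon_eval mdomU big_seq_fset1 cmUU expr1.
by rewrite -[RHS]mul1r -mpolyC1E.
Qed.

Lemma prod_mvars m : \prod_(v <- mvars m) e v = mon_eval m.
Proof.
rewrite /mvars big_flatten /= big_map /mon_eval; apply: eq_bigr => v _.
by rewrite big_nseq; elim: (m v) => [|k IH]; rewrite ?expr0 //= exprS IH.
Qed.

Lemma phiE p : phi p = \sum_(m <- msupp p) p@_m *: \prod_(v <- mvars m) e v.
Proof.
by rewrite /phi mmapE; apply: eq_bigr => m _; rewrite mul_malgC prod_mvars.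
Qed.

End Phi.

Lemma malgM_U1 n (m1 m2 : {cmonom (var n)}) :
  << m1 >> * << m2 >> = << mmul m1 m2 >> :> epoly n.
Proof. rewrite malgM_def fgmulUU mulr1; reflexivity. Qed.

Lemma prod_Xexp n (r : seq (var n)) (f : var n -> nat) :
  exists2 M : {cmonom (var n)}, \prod_(v <- r) X v ^+ f v = << M >>
    & forall w, M w = (\sum_(v <- r) (v == w) * f v)%N.
Proof.
elim: r => [|v r [M E HM]].
  by exists (mone : {cmonom (var n)}); [exact: big_nil | move=> w; rewrite big_nil cm1].
have [M' E' HM'] : exists2 M' : {cmonom (var n)}, X v ^+ f v = << M' >>
    & forall w, M' w = ((v == w) * f v)%N.
  elim: (f v) => [|k [M' E' HM']].
    by exists (mone : {cmonom (var n)}); [exact: expr0 | move=> w; rewrite cm1 muln0].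
  exists (mmul (ucm v) M').
    by rewrite exprS E'; exact: malgM_U1.
  by move=> w; rewrite cmM HM' cmU mulnS.
exists (mmul M' M).
  by rewrite big_cons E E'; exact: malgM_U1.
by move=> w; rewrite cmM HM HM' big_cons.
Qed.

Lemma mon_eval_X n (m : {cmonom (var n)}) : mon_eval (@X n) m = << m >>.
Proof.
rewrite /mon_eval; have [M -> HM] := prod_Xexp (finsupp m) m.
congr (<< _ >>); apply/eqP/cmP => w; rewrite HM.
have [wm|wm] := boolP (w \in finsupp m).
  rewrite (big_fsetD1 w) //= eqxx mul1n big_seq big1 ?addn0 // => v.
  by rewrite in_fsetD1 => /andP[/negPf -> _].
rewrite big_seq big1; last first.
  by move=> v vm; case: eqVneq wm => // <-; rewrite vm.
by move: wm; rewrite -cmE_eq0 => /eqP.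
Qed.

Lemma mem_mvars n (m : {cmonom (var n)}) v : v \in mvars m -> v \in finsupp m.
Proof.
by move=> /flatten_mapP [w wm]; rewrite mem_nseq => /andP[_ /eqP ->].
Qed.

Section PhiFacts.
Variables (n : nat) (e : var n -> epoly n).
Implicit Types (p q : epoly n) (v : var n) (m : {cmonom (var n)}).

Lemma phi_id p : (forall m, m \in msupp p -> forall v, v \in finsupp m -> e v = X v) ->
  phi e p = p.
Proof.
move=> H; rewrite phiE [RHS]monalgE big_seq [RHS]big_seq; apply: eq_bigr => m mp.
rewrite prod_mvars (_ : mon_eval e m = mon_eval (@X n) m).
  by rewrite mon_eval_X -mul_malgC malgM_def fgmulUU mulr1 mul1m.
rewrite /mon_eval; apply: eq_big_seq => v vm.
exact: (congr1 (fun x => x ^+ m v) (H m mp v vm)).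
Qed.

Lemma below_var k p m v : poly_below k p -> m \in msupp p -> v \in finsupp m -> vbelow k v.
Proof.
move=> B mp; rewrite -cmE_neq0; case: v => //= j; apply: contraR; rewrite -leqNgt => kj.
by rewrite (B _ _ mp kj).
Qed.

Lemma phi_below k p : poly_below k p -> (forall v, vbelow k v -> poly_below k (e v)) ->
  poly_below k (phi e p).
Proof.
move=> B He; rewrite phiE; apply: below_sum => m mp; apply: belowZ.
rewrite big_seq; apply: (big_ind (poly_below k)).
- exact: below1.
- by move=> x y; apply: belowM.
- by move=> v /mem_mvars vm; apply: He; apply: below_var B mp vm.
Qed.

Hypothesis e01 : forall v, e v = X v \/ e v = 0.

Lemma poly_sizeMe p v : (poly_size (p * e v) <= poly_size p)%N.
Proof.
by case: (e01 v) => ->; [rewrite mulrC poly_sizeXM | rewrite mulr0 poly_size0].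
Qed.

Lemma poly_size_term c (vs : seq (var n)) :
  (poly_size (c *: \prod_(v <- vs) e v)%R <= csize c * 2)%N.
Proof.
rewrite (leq_trans (poly_sizeZ _ _)) // leq_mul //.
elim: vs => [|v vs IH]; first by rewrite big_nil poly_size1.
by rewrite big_cons mulrC (leq_trans (poly_sizeMe _ _)).
Qed.

End PhiFacts.

(** * Binary representation of polynomials *)

Section RepPoly.
Variables (n : nat) (fs : seq (epoly n)) (e : var n -> epoly n) (l : var n -> nat) (k0 : nat).
Hypothesis e01 : forall v, e v = X v \/ e v = 0.
Hypothesis me : forall v, mulby fs k0 2 4 (e v).
Hypothesis l_inl : forall i, l (inl i) = 1%N.
Implicit Types (s t u : state fs) (p q : epoly n) (v z o : var n) (m : {cmonom (var n)}).

Record ready s z o : Prop := Ready {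
  ready_base : base s z o;
  ready_size : (k0 <= size (exts s))%N;
  ready_zero : known s 0 }.

Lemma ready_grow c s t z o : grow c s t -> ready s z o -> ready t z o.
Proof.
move=> g [B S Z]; split; [exact: base_grow g B | exact: leq_trans S (grow_size g) | exact: grow_mem g Z].
Qed.

(** Only extension variables fixed by [e] need a stored representation, of width one more than their
    length. An original variable is a bit by its Boolean axiom, and 0 is always represented. *)
Definition avail s v : Prop :=
  if v is inr _ then e v = X v -> rep s (l v + 1) (X v) else True.

Lemma avail_grow c s t v : grow c s t -> avail s v -> avail t v.
Proof. by move=> g; case: v => //= j H E; apply: rep_grow g (H E). Qed.

Lemma rep_zero s z o w : ready s z o -> rep s w 0.
Proof.
move=> [[[Bz _] _ _] _ Z]; exists (nseq w z), (nseq w z).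
have B : bits s (nseq w z) by move=> v; rewrite mem_nseq => /andP[_ /eqP ->].
by split; [exact: B | exact: B | rewrite size_nseq | rewrite size_nseq | rewrite subrr subr0].
Qed.

Lemma rep_var s z o v : ready s z o -> avail s v ->
  exists2 t, grow 4 s t & rep t (l v + 1) (e v).
Proof.
move=> R; case: (e01 v) => E; last first.
  by move=> _; exists s; [exact: growW (leq0n _) (grow_refl s) | rewrite E; exact: rep_zero R].
case: v E => [i|j] E A; last first.
  by exists s; [exact: growW (leq0n _) (grow_refl s) | rewrite E; exact: A E].
have vb k : vbelow k (inl i : var n) by [].
have [||t g m] := @add_line _ _ s (X (inl i) ^+ 2 - X (inl i)).
- by apply: belowB; [apply: belowXn|]; apply: belowX.
- exact: StepBoolean.
exists t.
  apply: growW g; rewrite (leq_trans (poly_sizeB _ _)) // expr2.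
  by rewrite (leq_trans (leq_add (poly_sizeXM _ _) (leqnn _))) // !poly_sizeX.
rewrite E l_inl; have [[[Bz Lz] _ _] _ _] := ready_grow g R.
(* Two bits, because the width is one more than the length, which is 1 for an original variable. *)
exists [:: inl i; z], [:: z; z].
split; [| | by [] | by [] |].
- by apply/bits_cons; split; [split | apply/bits_cons; split; [exact: Bz | exact: bits_nil]].
- by apply/bits_cons; split; [exact: Bz | apply/bits_cons; split; [exact: Bz | exact: bits_nil]].
- have -> : X (inl i) - (binval [:: inl i; z] - binval [:: z; z]) = X z :> epoly n; last exact: Lz.
  by rewrite !binval_cons; poly_ring.
Qed.

End RepPoly.

Section RepPoly2.
Variables (n : nat) (fs : seq (epoly n)) (e : var n -> epoly n) (l : var n -> nat) (k0 : nat).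
Hypothesis e01 : forall v, e v = X v \/ e v = 0.
Hypothesis me : forall v, mulby fs k0 2 4 (e v).
Hypothesis l_inl : forall i, l (inl i) = 1%N.
Implicit Types (s t u : state fs) (p q : epoly n) (v z o : var n) (m : {cmonom (var n)}).

Notation ready := (ready k0).
Notation avail := (avail e l).

Definition pad_cost W T := (2 * (W * (2 * binval_bound W + 2)) + 2 * T + 14 * binval_bound W)%N.
Definition factor_cost W T := (4 + mul_cost W T + pad_cost W T)%N.

(** Factors of lengths $s$ and $t$ have widths $s + 1$ and $t + 1$, and their product has width $s +
    t + 3$; one bit of padding gives $s + t + 4$, the length of the gate plus one. Multiplying by
    [e v] never enlarges a polynomial, so [T] is the same throughout. *)
Lemma rep_prod W T C p vs s z o : ready s z o -> (forall v, v \in vs -> avail s v) ->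
  rep s (clenv l C + 1) p -> (poly_size p <= T)%N ->
  (clenv l (foldl (@CMul _) C (map (@CVar _) vs)) + 2 <= W)%N ->
  exists2 t, grow (size vs * factor_cost W T) s t
    & rep t (clenv l (foldl (@CMul _) C (map (@CVar _) vs)) + 1) (p * \prod_(v <- vs) e v).
Proof.
elim: vs C p s => [|v vs IH] C p s R A Rp Tp leW.
  by exists s; [exact: grow_refl | rewrite big_nil mulr1].
have [t1 g1 Rv] := rep_var e01 l_inl R (A v (mem_head _ _)).
have R1 := ready_grow g1 R; have Rp1 := rep_grow g1 Rp.
have leW' : (clenv l C + l v + 5 <= W)%N.
  by move: leW; rewrite clenv_foldl_mul big_cons; lia.
have mv : mulby fs (size (exts t1)) 2 4 (e v).
  by apply: mulbyW (me v) _ _ _ => //; case: R1.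
have [B1 _ _] := R1.
have [|t2 g2 R2] := rep_mul (W := W) B1 Rp1 Rv Tp mv; first lia.
have R3 := ready_grow g2 R1; have [B3 _ _] := R3.
have Tpv := leq_trans (poly_sizeMe e01 p v) Tp.
have [||t3 g3 R4] := rep_pad (W := W) (w' := clenv l (CMul C (CVar v)) + 1) B3 R2 Tpv.
- by rewrite /=; lia.
- by rewrite /=; lia.
have g := grow_trans (grow_trans g1 g2) g3.
have [||t4 g4 R5] := IH (CMul C (CVar v)) (p * e v) t3 (ready_grow g3 R3) _ R4 Tpv.
- move=> u uvs; apply: avail_grow g _; apply: A; by rewrite in_cons uvs orbT.
- exact: leW.
exists t4; last by rewrite big_cons mulrA; exact: R5.
by apply: growW (grow_trans g g4); rewrite [size _]/= mulSn.
Qed.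

Definition monomial_cost W T D := (4 + const_cost W + D * factor_cost W T)%N.

Lemma rep_monomial W T D c vs s z o : ready s z o -> (forall v, v \in vs -> avail s v) ->
  (csize c <= T)%N -> (2 <= T)%N -> (size vs <= D)%N ->
  (clenv l (mcirc c vs) + 2 <= W)%N ->
  exists2 t, grow (monomial_cost W T D) s t
    & rep t (clenv l (mcirc c vs) + 1) (c *: \prod_(v <- vs) e v).
Proof.
move=> R A Tc T2 leD; have [B _ _] := R.
rewrite /mcirc; have [->|c1] := eqVneq c 1.
  rewrite scale1r; case: vs A leD => [|v vs] A leD leW.
    have [||t g R1] := rep_const (W := W) (w := 1) (c := 1) B; rewrite ?big_nil //.
      by move: leW; rewrite /=; lia.
    exists t; first by apply: growW g; rewrite /monomial_cost; lia.
    by rewrite -mpolyC1E; exact: R1.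
  have [t1 g1 Rv] := rep_var e01 l_inl R (A v (mem_head _ _)).
  have Tv : (poly_size (e v) <= T)%N.
    by apply: leq_trans T2; case: (me v).
  have [|t2 g2 R2] := rep_prod (C := CVar v) (W := W) (T := T) (vs := vs) (ready_grow g1 R) _ Rv Tv leW.
    by move=> u uvs; apply: avail_grow g1 _; apply: A; rewrite in_cons uvs orbT.
  exists t2; last by rewrite big_cons; exact: R2.
  apply: growW (grow_trans g1 g2); rewrite /monomial_cost.
  have : (size vs * factor_cost W T <= D * factor_cost W T)%N by rewrite leq_mul // ltnW.
  lia.
rewrite [circuit_fold _ _ _]/= => leW.
have leW1 : (up_log 2 (absz c) + 2 <= W)%N.
  by apply: leq_trans leW; rewrite clenv_foldl_mul /=; lia.
(* The extra bit is needed when $|c|$ is a power of two, since [up_log] only gives $|c| \le 2^w$. *)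
have [||t1 g1 R1] := rep_const (W := W) (w := up_log 2 (absz c) + 1) (c := c) B.
- lia.
- by rewrite addn1 expnS; have := @up_logP 2 (absz c) isT; lia.
have Tc' : (poly_size (c%:MP : epoly n) <= T)%N by rewrite poly_sizeC.
have [|t2 g2 R2] := rep_prod (C := CConst _ c) (W := W) (T := T) (vs := vs) (ready_grow g1 R) _ R1 Tc' leW.
  by move=> u uvs; apply: avail_grow g1 _; apply: A.
exists t2; last by rewrite -mul_malgC; exact: R2.
apply: growW (grow_trans g1 g2); rewrite /monomial_cost.
have : (size vs * factor_cost W T <= D * factor_cost W T)%N by rewrite leq_mul.
lia.
Qed.

Definition term_cost W T D := (monomial_cost W T D + 2 * pad_cost W T + add_cost W T)%N.

(** [C] and [p] are the circuit and the value of the partial sum. [T] bounds the partial sum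
    together with all remaining terms, hence every intermediate polynomial. *)
Lemma rep_sum (I : eqType) W T D (c : I -> int) (vs : I -> seq (var n)) (r : seq I) C p s z o :
  ready s z o -> (forall i, i \in r -> forall v, v \in vs i -> avail s v) ->
  (forall i, i \in r -> (csize (c i) * 2 <= T)%N) -> (2 <= T)%N ->
  (forall i, i \in r -> (size (vs i) <= D)%N) ->
  rep s (clenv l C + 1) p -> (poly_size p + \sum_(i <- r) csize (c i) * 2 <= T)%N ->
  (clenv l (foldl (@CAdd _) C [seq mcirc (c i) (vs i) | i <- r]) + 3 <= W)%N ->
  exists2 t, grow (size r * term_cost W T D) s t
    & rep t (clenv l (foldl (@CAdd _) C [seq mcirc (c i) (vs i) | i <- r]) + 1)
        (p + \sum_(i <- r) c i *: \prod_(v <- vs i) e v).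
Proof.
elim: r C p s => [|i r IH] C p s R A Tc T2 leD Rp Tp leW.
  by exists s; [exact: grow_refl | rewrite big_nil addr0].
have ir : i \in i :: r := mem_head _ _.
have sub j : j \in r -> j \in i :: r by move=> jr; rewrite in_cons jr orbT.
pose C' := CAdd C (mcirc (c i) (vs i)).
have leW' : (clenv l C' + 3 <= W)%N.
  apply: leq_trans leW; rewrite leq_add2r /=.
  by case: (clenv_foldl_add l C' [seq mcirc (c i) (vs i) | i <- r]) => H _; apply: leq_trans H; rewrite leq_addr.
have leC : (clenv l C + 4 <= W)%N by move: leW'; rewrite /=; lia.
have leM : (clenv l (mcirc (c i) (vs i)) + 4 <= W)%N by move: leW'; rewrite /=; lia.
have Tb := Tc i ir.
have [||t1 g1 R1] := rep_monomial (W := W) (T := T) (D := D) (c := c i) (vs := vs i) R (A i ir) _ T2 (leD i ir).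
- by lia.
- by lia.
have Ra1 := ready_grow g1 R; have [B1 _ _] := Ra1.
have Tm := leq_trans (poly_size_term e01 (c i) (vs i)) Tb.
have Tp' : (poly_size p <= T)%N by lia.
(* The width of the sum gate is [w + 1], so both summands are padded to [w]. *)
pose w := (maxn (clenv l C) (clenv l (mcirc (c i) (vs i))) + 1)%N.
have leww : (w < W)%N by rewrite /w; lia.
have [||t2 g2 R2] := rep_pad (W := W) (w' := w) B1 (rep_grow g1 Rp) Tp'; [rewrite /w; lia | lia |].
have [||t3 g3 R3] := rep_pad (W := W) (w' := w) (base_grow g2 B1) (rep_grow g2 R1) Tm; [rewrite /w; lia | lia |].
have [t4 g4 R4] := rep_add (base_grow g3 (base_grow g2 B1)) (rep_grow g3 R2) R3 Tp' Tm leww.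
have g := grow_trans (grow_trans (grow_trans g1 g2) g3) g4.
have R5 : rep t4 (clenv l C' + 1) (p + c i *: \prod_(v <- vs i) e v).
  have -> : (clenv l C' + 1 = w.+1)%N by rewrite /w /=; lia.
  exact: R4.
have [| | | | |t5 g5 R6] := IH C' _ t4 (ready_grow g R) _ _ T2 _ R5.
- by move=> j jr v vj; apply: avail_grow g _; apply: A vj; apply: sub.
- by move=> j jr; apply: Tc; apply: sub.
- by move=> j jr; apply: leD; apply: sub.
- move: Tp; rewrite big_cons addnA; apply: leq_trans; rewrite leq_add2r.
  by rewrite (leq_trans (poly_sizeD _ _)) // leq_add2l poly_size_term.
- exact: leW.
exists t5; last by rewrite big_cons addrA; exact: R6.
apply: growW (grow_trans g g5); change (size (i :: r)) with (size r).+1.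
rewrite (mulSn (size r)) leq_add2r /term_cost -!/(pad_cost W T).
move: (monomial_cost W T D) (add_cost W T) (pad_cost W T) => x y x'; lia.
Qed.

(** There are at most $L + 1$ monomials, with coefficients of size at most $L + 2$; the factor 2 is
    the size bound of a product of images of variables. *)
Definition poly_bound L := (2 * ((L + 1) * (L + 2)) + 2)%N.
Definition poly_cost L := ((L + 1) * term_cost (L + 4) (poly_bound L) (L + 1))%N.

Lemma csize_le c k : (absz c <= 2 ^ k)%N -> (csize c <= k + 2)%N.
Proof.
rewrite /csize; case: eqP => // /eqP c0 le; rewrite /bitsize.
have H : (0 < absz c)%N by rewrite absz_gt0.
have : (2 ^ trunc_log 2 (absz c) <= 2 ^ k)%N by apply: leq_trans (trunc_logP _ H) le.
by rewrite leq_exp2l //; lia.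
Qed.

Lemma term_bounds L q : (plen l q <= L)%N -> (size (msupp q) <= L + 1)%N /\
  forall m, m \in msupp q -> (size (mvars m) <= L + 1)%N /\ (csize q@_m * 2 <= 2 * (L + 2))%N.
Proof.
move=> leL; have [S1 S2] := poly_circuit_bounds l q; split; first lia.
move=> m mq; have [H1 _ H3] := mcirc_bounds l q@_m (mvars m).
have H4 := leq_trans (S2 m mq) leL; split; first lia.
have := csize_le H3; lia.
Qed.

Lemma rep_poly L q s z o : ready s z o -> (plen l q <= L)%N ->
  (forall m v, m \in msupp q -> v \in mvars m -> avail s v) ->
  exists2 t, grow (poly_cost L) s t & rep t (plen l q + 1) (phi e q).
Proof.
move=> R leL A; rewrite phiE /plen /poly_circuit.
have [_ S2] := poly_circuit_bounds l q.
have [S3 HB] := term_bounds leL.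
have SE : (\sum_(m <- msupp q) csize q@_m * 2 <= (L + 1) * (2 * (L + 2)))%N.
  apply: (@leq_trans (\sum_(m <- msupp q) (2 * (L + 2)))%N).
    by rewrite big_seq [leqRHS]big_seq; apply: leq_sum => m /HB [].
  by rewrite big_const_seq count_predT iter_addn_0 mulnC leq_mul.
have leP : (clenv l (poly_circuit q) + 3 <= L + 4)%N by move: leL; rewrite /plen; lia.
have {}S2 : forall m, m \in enum_fset (msupp q) -> (clenv l (mcirc q@_m (mvars m)) <= L)%N.
  by move=> m mq; apply: leq_trans (S2 m mq) leL.
have {}HB : forall m, m \in enum_fset (msupp q) ->
  (size (mvars m) <= L + 1)%N /\ (csize q@_m * 2 <= 2 * (L + 2))%N by [].
have {}A : forall m v, m \in enum_fset (msupp q) -> v \in mvars m -> avail s v := A.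
move: S2 S3 SE HB A leP; rewrite /plen /poly_circuit; clear leL.
have -> : [seq monomial_circuit q@_m m | m <- enum_fset (msupp q)] =
  [seq mcirc q@_m (mvars m) | m <- enum_fset (msupp q)].
  by apply: eq_map => m; apply: monomial_circuitE.
case: (enum_fset (msupp q)) => [|m r] S2 S3 SE HB A leP.
  exists s; first exact: growW (leq0n _) (grow_refl s).
  by rewrite big_nil; exact: rep_zero R.
have mr : m \in m :: r := mem_head _ _.
have sub j : j \in r -> j \in m :: r by move=> jr; rewrite in_cons jr orbT.
have TBE : (2 * (L + 2) <= poly_bound L)%N by rewrite /poly_bound; nia.
have T2 : (2 <= poly_bound L)%N by rewrite /poly_bound; lia.
have [HD HT] := HB m mr.
have leM : (clenv l (mcirc q@_m (mvars m)) + 2 <= L + 4)%N.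
  by apply: leq_trans (leq_add (S2 m mr) (leqnn 2)) _; rewrite leq_add2l.
have [|t1 g1 R1] := rep_monomial (W := L + 4) (T := poly_bound L) (D := L + 1) R (fun v => A m v mr) _ T2 HD leM.
  by apply: leq_trans TBE; apply: leq_trans HT; rewrite leq_pmulr.
have [| | | |t2 g2 R2] := rep_sum (W := L + 4) (T := poly_bound L) (D := L + 1)
  (c := fun m => q@_m) (vs := @mvars n) (r := r) (ready_grow g1 R) _ _ T2 _ R1 _ leP.
- by move=> j jr v vj; apply: avail_grow g1 _; apply: A vj; apply: sub.
- by move=> j /sub /HB [_ H]; apply: leq_trans TBE.
- by move=> j /sub /HB [].
- apply: leq_trans (leq_add (poly_size_term e01 _ _) (leqnn _)) _.
  by move: SE; rewrite big_cons /poly_bound mulnCA => SE; apply: leq_trans SE (leq_addr _ _).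
exists t2; last by rewrite big_cons; exact: R2.
apply: growW (grow_trans g1 g2); rewrite /poly_cost.
apply: leq_trans (_ : (size r).+1 * term_cost (L + 4) (poly_bound L) (L + 1) <= _)%N; last by rewrite leq_mul.
by rewrite mulSn leq_add2r /term_cost; lia.
Qed.
End RepPoly2.

Section SqrtPhi.
Variables (n : nat) (fs : seq (epoly n)) (e : var n -> epoly n) (l : var n -> nat) (k0 : nat).
Hypothesis e01 : forall v, e v = X v \/ e v = 0.
Hypothesis eb : forall v, e v = X v -> vbelow k0 v.
Hypothesis l_inl : forall i, l (inl i) = 1%N.
Implicit Types (s t u : state fs) (p q g : epoly n) (v z o : var n) (m : {cmonom (var n)}).

Notation ready := (ready k0).
Notation avail := (avail e l).

Lemma mulby_zero N K : mulby fs k0 N K 0.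
Proof.
have -> : 0 = 0%:MP :> epoly n by rewrite malgC0E.
exact: mulbyW (mulbyC fs k0 0) (leqnn _) (leq0n _) (leq0n _).
Qed.

Lemma mulby_eM N K v g : mulby fs k0 N K g -> mulby fs k0 N (K + N) (e v * g).
Proof.
move=> mg; case: (e01 v) => E; rewrite E; last by rewrite mul0r; exact: mulby_zero.
exact: mulby_XM (eb E) mg.
Qed.

Lemma mulby_e v : mulby fs k0 2 4 (e v).
Proof. by rewrite -[e v]mulr1; exact: mulby_eM (mulby1 fs k0). Qed.

Lemma mulby_prod (vs : seq (var n)) :
  mulby fs k0 2 (2 + size vs * 2) (\prod_(v <- vs) e v).
Proof.
elim: vs => [|v vs IH]; first by rewrite big_nil; exact: mulby1.
rewrite big_cons [size _]/= mulSnr addnA; exact: mulby_eM IH.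
Qed.

Lemma mulby_sum (I : eqType) (r : seq I) (F : I -> epoly n) N K R :
  (forall i, i \in r -> mulby fs k0 N K (F i)) -> (size r <= R)%N ->
  mulby fs k0 (size r * N) (size r * (K + R * N)) (\sum_(i <- r) F i).
Proof.
elim: r => [|i r IH] H leR; first by rewrite big_nil; exact: mulby_zero.
rewrite big_cons [size _]/=; have Hi := H i (mem_head _ _).
have Hr := IH (fun j jr => H j ltac:(by rewrite in_cons jr orbT)) (ltnW leR).
apply: mulbyW (mulbyD Hi Hr) (leqnn _) _ _; first by rewrite mulSn.
rewrite (mulSn (size r)) -addnA -addnA leq_add2l addnC leq_add2r -mulSn.
by rewrite leq_mul2r leR orbT.
Qed.

Definition mulby_bound L := ((L + 1) * (2 + (L + 1) * 2 + 2 * (L + 2) + (L + 1) * (2 * (L + 2))))%N.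

Lemma mulby_phi L q : (plen l q <= L)%N -> mulby fs k0 (poly_bound L) (mulby_bound L) (phi e q).
Proof.
move=> leL; have [H1 H2] := term_bounds leL; rewrite phiE.
have H m : m \in msupp q -> mulby fs k0 (2 * (L + 2)) (2 + (L + 1) * 2 + 2 * (L + 2))
    (q@_m *: \prod_(v <- mvars m) e v).
  move=> /H2 [H3 H4]; rewrite -mul_malgC.
  apply: mulbyW (mulbyM (mulbyC fs k0 q@_m) (mulby_prod (mvars m))) (leqnn _) (H4) _.
  exact: leq_add (leq_add (leqnn 2) (leq_mul H3 (leqnn 2))) H4.
apply: mulbyW (mulby_sum H H1) (leqnn _) _ _.
  apply: leq_trans (leq_mul H1 (leqnn _)) _.
  by rewrite /poly_bound mulnCA leq_addr.
by rewrite /mulby_bound leq_mul.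
Qed.

Lemma poly_size_phi L q : (plen l q <= L)%N -> (poly_size (phi e q) <= poly_bound L)%N.
Proof. by move=> /mulby_phi []. Qed.

(** One scale dominating the width, the size and the multiplication cost of a line. *)
Definition sqrt_scale L := (L + 4 + poly_bound L + mulby_bound L)%N.

End SqrtPhi.

Lemma sqrt_phi : exists c d, forall n (fs : seq (epoly n)) e l k0,
  (forall v, e v = X v \/ e v = 0) -> (forall v, e v = X v -> vbelow k0 v) ->
  (forall i, l (inl i) = 1%N) ->
  forall L (s : state fs) z o q, ready k0 s z o -> (plen l q <= L)%N ->
  (forall m v, m \in msupp q -> v \in mvars m -> avail e l s v) ->
  phi e q ^+ 2 known_in s ->
  exists2 t, grow (poly_cost L + c * sqrt_scale L ^ d) s t & phi e q known_in t.
Proof.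
have [c [d elim]] := sqrt_elim; exists c, d => n fs e l k0 e01 eb l_inl L s z o q R leL A Hq.
have me v := mulby_e fs e01 eb v.
have [t1 g1 R1] := rep_poly e01 me l_inl R leL A.
have [B1 S1 _] := ready_grow g1 R.
have mq := mulby_phi fs e01 eb leL.
have h1 : (L + 2 < sqrt_scale L)%N by rewrite /sqrt_scale; lia.
have h2 : (poly_bound L <= sqrt_scale L)%N by rewrite /sqrt_scale; lia.
have h3 : (mulby_bound L <= sqrt_scale L)%N by rewrite /sqrt_scale; lia.
have h4 : (0 < plen l q + 1)%N by rewrite addn1.
have h5 : (plen l q + 1 < L + 2)%N by lia.
have [t2 g2 K2] := elim _ _ _ _ h1 h2 h3 _ _ _ _ _ _ _ _ B1 R1 h4 h5 mq S1 (grow_mem g1 Hq).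
by exists t2; [exact: grow_trans g1 g2 | exact: K2].
Qed.

(** * Lengths of extension variables and lines of length 0 *)

Section Extensions.
Variable n : nat.
Implicit Types (p q : epoly n) (qs : seq (epoly n)) (v : var n) (m : {cmonom (var n)}).

Fixpoint all_vars (V : Type) (P : V -> Prop) (C : circuit V) : Prop :=
  match C with
  | CVar v => P v
  | CConst _ => True
  | CAdd A B | CMul A B => all_vars P A /\ all_vars P B
  end.

Lemma clenv_ext (V : Type) (l1 l2 : V -> nat) C :
  all_vars (fun x => l1 x = l2 x) C -> clenv l1 C = clenv l2 C.
Proof. by elim: C => //= A IHA B IHB [/IHA -> /IHB ->]. Qed.

Lemma all_vars_fold (V : Type) (P : V -> Prop) (op : circuit V -> circuit V -> circuit V) C0 s :
  (forall A B, all_vars P A -> all_vars P B -> all_vars P (op A B)) -> all_vars P C0 ->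
  (forall C, List.In C s -> all_vars P C) -> all_vars P (circuit_fold op C0 s).
Proof.
move=> Hop H0; case: s => [|C s] //= H.
have HC : all_vars P C by apply: H; left.
have {H} : forall D, List.In D s -> all_vars P D by move=> D Ds; apply: H; right.
elim: s C HC => //= D s IH C HC H; apply: IH; first by apply: Hop => //; apply: H; left.
by move=> E Es; apply: H; right.
Qed.

Lemma In_map_inv (T : eqType) (V : Type) (f : T -> V) s y :
  List.In y (map f s) -> exists2 x, x \in s & y = f x.
Proof.
elim: s => //= x s IH [<-|/IH [x' xs ->]]; first by exists x; rewrite ?mem_head.
by exists x' => //; rewrite in_cons xs orbT.
Qed.

Lemma plen_ext (l1 l2 : var n -> nat) p :
  (forall m v, m \in msupp p -> v \in mvars m -> l1 v = l2 v) -> plen l1 p = plen l2 p.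
Proof.
move=> H; apply: clenv_ext; apply: all_vars_fold => // C HC.
have [m mp ->] := In_map_inv HC.
rewrite monomial_circuitE; apply: all_vars_fold => // D.
have HV : List.In D (map (@CVar _) (mvars m)) -> all_vars (fun x => l1 x = l2 x) D.
  by move=> HD; have [v vm ->] := In_map_inv HD; apply: H vm.
by case: ifP => _ //= [<-|] //.
Qed.

Definition elen qs v : nat :=
  circuit_length (if v is inr j then nth (CVar v) (extension_circuits qs) j else CVar v).

Lemma syntactic_sizeE qs p : syntactic_size qs p = plen (elen qs) p.
Proof. by rewrite /syntactic_size /expand clenv_subst. Qed.

Lemma extension_circuits_rcons qs q : extension_circuits (rcons qs q) =
  rcons (extension_circuits qs) (expand (extension_circuits qs) (poly_circuit q)).
Proof. by rewrite /extension_circuits foldl_rcons. Qed.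

Lemma size_extension_circuits qs : size (extension_circuits qs) = size qs.
Proof.
by elim/last_ind: qs => // qs q IH; rewrite extension_circuits_rcons !size_rcons IH.
Qed.

Lemma elen_rcons qs q v : vbelow (size qs) v -> elen (rcons qs q) v = elen qs v.
Proof.
case: v => // j /= lj; rewrite /elen extension_circuits_rcons nth_rcons.
by rewrite size_extension_circuits lj.
Qed.

(** The circuit of $y_j$ is formed from the earlier circuits only; measuring $q_j$ with all of them
    is the same, as no later variable occurs in it. *)
Lemma elen_ext qs j : extensions qs -> (j < size qs)%N ->
  elen qs (inr j) = plen (elen qs) qs`_j.
Proof.
elim/last_ind: qs => // qs q IH Hq; rewrite size_rcons ltnS leq_eqVlt => /orP[/eqP ->|lj].
  have Bq := Hq (size qs); rewrite size_rcons nth_rcons ltnn eqxx in Bq.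
  rewrite nth_rcons ltnn eqxx {1}/elen extension_circuits_rcons nth_rcons.
  rewrite size_extension_circuits ltnn eqxx -[circuit_length _]/(syntactic_size qs q).
  rewrite syntactic_sizeE; apply: plen_ext => m v mq /mem_mvars vm; rewrite elen_rcons //.
  exact: below_var (Bq (ltnSn _)) mq vm.
have Hqs : extensions qs.
  move=> i li; have := Hq i; rewrite size_rcons nth_rcons li; apply.
  exact: ltnW.
rewrite elen_rcons // IH // nth_rcons lj; apply: plen_ext => m v mq /mem_mvars vm.
rewrite elen_rcons //; apply: vbelowW (ltnW lj) _; exact: below_var (Hqs j lj) mq vm.
Qed.

End Extensions.

Lemma phi_X n (p : epoly n) : phi (@X n) p = p.
Proof. by apply: phi_id. Qed.

(** Any sum gate or product gate has positive length, so there is at most one monomial, and it is a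
    constant or a bare variable; original variables are excluded by their length 1. *)
Lemma zero_length n (l : var n -> nat) (p : epoly n) :
  (forall i, l (inl i) = 1%N) -> plen l p = 0%N ->
  [\/ p = 0, p = 1, p = - 1 | exists j, p = X (inr j)].
Proof.
move=> l_inl; have E := phiE (@X n) p; rewrite phi_X in E.
have [H _] := poly_circuit_bounds l p => p0; rewrite p0 add0n in H.
move: H p0; rewrite /plen /poly_circuit.
have -> : [seq monomial_circuit p@_m m | m <- enum_fset (msupp p)] =
  [seq mcirc p@_m (mvars m) | m <- enum_fset (msupp p)].
  by apply: eq_map => m; apply: monomial_circuitE.
move: E; case: (enum_fset (msupp p)) => [|m [|m' r]] E; last by [].
  by move=> _ _; apply: Or41; rewrite E big_nil.
rewrite big_seq1 in E; move=> _; rewrite [circuit_fold _ _ _]/= /mcirc.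
move: E; set c := p@_m; clearbody c => ->; have [->|c1] := eqVneq c 1.
  rewrite scale1r; case: (mvars m) => [|v [|v' vs]].
  - by move=> _; apply: Or42; rewrite big_nil.
  - rewrite big_seq1 /=; case: v => [i|j]; first by rewrite l_inl.
    by move=> _; apply: Or44; exists j.
  - by rewrite [circuit_fold _ _ _]/= clenv_foldl_mul /=; lia.
rewrite [circuit_fold _ _ _]/= clenv_foldl_mul [clenv _ (CConst _ _)]/=.
case: (mvars m) => [|v vs]; last by rewrite big_cons; lia.
rewrite !big_nil addn0 => H.
have := @up_logP 2 (absz c) isT; rewrite H expn0.
have -> : c *: 1 = c%:MP :> epoly n by rewrite -mul_malgC mulr1.
move=> lec.
have [->|->] : c = 0 \/ c = -1 by lia.
  by apply: Or41; rewrite malgC0E.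
by apply: Or43; rewrite monalgUN.
Qed.

Lemma leq_sum_mem (T : eqType) (F : T -> nat) x s : x \in s -> (F x <= \sum_(y <- s) F y)%N.
Proof. by move=> xs; rewrite (big_rem x) //= leq_addr. Qed.

Lemma phi_sum n (e : var n -> epoly n) (I : Type) (r : seq I) (F : I -> epoly n) :
  phi e (\sum_(i <- r) F i) = \sum_(i <- r) phi e (F i).
Proof. exact: (big_morph (phi e) (phiD e) (phi0 e)). Qed.

(** * Simulation of a refutation *)

Section Main.
Variables (n : nat) (qs rs : seq (epoly n)).
Hypothesis Hqs : extensions qs.
Implicit Types (p q r : epoly n) (v z o : var n) (i j : nat).

(** If the axiom is a line, its length bounds the length of $y_j$, hence the number of bits to
    introduce. If moreover $q_j \neq 0$, that line has positive length, so that these variables can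
    be counted. *)
Definition is_live j := [&& (j < size qs)%N, X (inr j) - qs`_j \in rs & qs`_j != 0].
Definition esub v : epoly n := if v is inr j then if is_live j then X v else 0 else X v.
Let l := elen qs.
Let L := refutation_syntactic_size qs rs.

Lemma esub01 v : esub v = X v \/ esub v = 0.
Proof. by rewrite /esub; case: v => [i|j]; [left | case: ifP; [left | right]]. Qed.

Lemma X_neq0 v : X v != 0 :> epoly n.
Proof.
apply/eqP => E; have := poly_sizeX v; rewrite E poly_size0; discriminate.
Qed.

Lemma esub_live j : esub (inr j) = X (inr j) -> is_live j.
Proof.
rewrite /esub; case: ifP => // _ E; case/eqP: (X_neq0 (inr j)); exact: esym E.
Qed.

Lemma esub_below_size v : esub v = X v -> vbelow (size qs) v.
Proof. by case: v => // j /esub_live /and3P[]. Qed.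

Lemma esub_below k v : vbelow k v -> poly_below k (esub v).
Proof. by move=> vb; case: (esub01 v) => ->; [apply: belowX | apply: below0]. Qed.

Lemma l_inl (i : 'I_n) : l (inl i) = 1%N. Proof. by []. Qed.

Lemma line_len r : r \in rs -> (plen l r <= L)%N.
Proof.
move=> rrs; rewrite -syntactic_sizeE; exact: (leq_sum_mem (syntactic_size qs) rrs).
Qed.

Lemma coefX v m : (X v : epoly n)@_m = (ucm v == m)%:R.
Proof. exact: mcoeffU1. Qed.

Lemma below_coef k q j : poly_below k q -> (k <= j)%N -> q@_(ucm (inr j)) = 0.
Proof.
move=> B kj; apply/mcoeff_outdom/negP => mq.
by have := B _ _ mq kj; rewrite cmUU.
Qed.

Lemma axiom_top j : (j < size qs)%N -> (X (inr j) - qs`_j)@_(ucm (inr j)) = 1.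
Proof.
move=> lj; rewrite mcoeffB coefX eqxx (below_coef (Hqs lj) (leqnn _)); exact: subr0.
Qed.

(** The coefficient of the later variable is 1 in its own axiom and 0 in the earlier one. Live
    variables are therefore counted by the lines that are their axioms. *)
Lemma axiom_inj j k : (j < k)%N -> (k < size qs)%N -> X (inr j) - qs`_j != X (inr k) - qs`_k.
Proof.
move=> jk lk; apply/eqP => E; have := axiom_top lk; rewrite -E mcoeffB coefX.
rewrite (below_coef (Hqs (ltn_trans jk lk)) (ltnW jk)).
have -> : (ucm (inr j) == ucm (inr k) :> {cmonom (var n)}) = false; last by [].
apply/negP => /cmP /(_ (inr k)); rewrite !ucmE eqxx; case: eqP => // -[E1] _.
by move: jk; rewrite E1 ltnn.
Qed.

(** The monomial $y_j$ and some monomial of $q_j$ both survive in the axiom, and two monomials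
    require a sum gate. *)
Lemma live_len j : is_live j -> (0 < plen l (X (inr j) - qs`_j))%N.
Proof.
case/and3P => lj _ q0; have [H _] := poly_circuit_bounds l (X (inr j) - qs`_j).
have [m mq] : exists m, m \in msupp qs`_j.
  by apply/fset0Pn; rewrite msupp_eq0.
have mj : m (inr j) = 0%N := Hqs lj mq (leqnn j).
have neq : ucm (inr j) != m :> {cmonom (var n)}.
  by apply/eqP => E; move: mj; rewrite -E ucmE eqxx.
have : (size [:: ucm (inr j); m] <= size (msupp (X (inr j) - qs`_j)))%N.
  apply: uniq_leq_size; first by rewrite /= inE neq.
  move=> m'; rewrite !inE => /orP[/eqP ->|/eqP ->].
    by rewrite -mcoeff_neq0 axiom_top.
  rewrite -mcoeff_neq0 mcoeffB coefX (negPf neq) mulr0n sub0r oppr_eq0.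
  by rewrite mcoeff_neq0.
by move=> H2; have := leq_trans H2 H; rewrite addn1 ltnS.
Qed.

Definition live_vars := [seq j <- iota 0 (size qs) | is_live j].
Definition long_lines := [seq r <- rs | (0 < plen l r)%N].

Lemma size_long_lines : (size long_lines <= L)%N.
Proof.
rewrite /long_lines size_filter /L /refutation_syntactic_size.
elim: (rs) => [|r r' IH]; first by rewrite big_nil.
by rewrite big_cons /= syntactic_sizeE leq_add //; case: (plen _ _).
Qed.

Lemma size_live_vars : (size live_vars <= L)%N.
Proof.
apply: leq_trans size_long_lines; rewrite -(size_map (fun j => X (inr j) - qs`_j)).
apply: uniq_leq_size.
  rewrite map_inj_in_uniq; first by rewrite filter_uniq // iota_uniq.
  move=> j k; rewrite !mem_filter => /andP[/and3P[lj _ _] _] /andP[/and3P[lk _ _] _] E.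
  have [jk|kj|jk] := ltngtP j k; last exact: jk.
    by case/eqP: (axiom_inj jk lk); exact: E.
  by case/eqP: (axiom_inj kj lj); exact: esym E.
move=> r /mapP [j]; rewrite mem_filter => /andP[lj _] ->.
by rewrite mem_filter live_len //; case/and3P: lj.
Qed.

(** At most $L$ lines have positive length. The images of the others are 0, 1, -1 or one of at most
    $L$ live variables. *)
Lemma size_images : (size (undup (map (phi esub) rs)) <= 2 * L + 3)%N.
Proof.
have H : {subset undup (map (phi esub) rs) <=
    map (phi esub) long_lines ++ [:: 0; 1; - 1] ++ [seq X (inr j) | j <- live_vars]}.
  move=> p; rewrite mem_undup => /mapP [r rrs ->]; rewrite !mem_cat.
  have [pos|] := posnP (plen l r); last first.
    by move=> pos; rewrite map_f // mem_filter pos.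
  have [->|->|->|[j E]] := zero_length l_inl pos.
  - by rewrite phi0 !inE eqxx !orbT.
  - by rewrite phi1 !inE eqxx !orbT.
  - by rewrite phiN phi1 (mem_last 0 [:: 1; - 1]) !orbT.
  rewrite E phiX; case: (esub01 (inr j)) => Ej; last by rewrite Ej !inE eqxx !orbT.
  rewrite Ej (map_f (fun j => X (inr j))) ?orbT // mem_filter esub_live //=.
  by rewrite mem_iota add0n; case/and3P: (esub_live Ej).
apply: leq_trans (uniq_leq_size (undup_uniq _) H) _.
rewrite !size_cat !size_map /=; have := size_long_lines; have := size_live_vars; lia.
Qed.

End Main.

Definition def_cost K := (poly_cost K + (2 * (2 + poly_bound K) + 4 * (poly_bound K + 2 * binval_bound (K + 1)) + 10))%N.

Section Simulation.
Variables (n : nat) (fs qs rs : seq (epoly n)).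
Hypothesis Bfs : forall f, f \in fs -> poly_below 0 f.
Hypothesis Hqs : extensions qs.
Hypothesis Hrs : forall i, (i < size rs)%N ->
  poly_below (size qs) rs`_i /\ step true fs qs (take i rs) rs`_i.
Implicit Types (s t u : state fs) (p q r : epoly n) (v z o : var n) (i j : nat).

Notation e := (@esub n qs rs).
Notation live := (@is_live n qs rs).
Notation l := (elen qs).
Notation L := (refutation_syntactic_size qs rs).
Notation ready := (ready (size qs)).
Notation avail := (avail e l).

Definition phi_axioms := map (phi e) qs.

Lemma valid_phi_axioms : valid fs phi_axioms [::].
Proof.
split=> // j; rewrite size_map => lj; rewrite (nth_map 0) //.
by apply: phi_below (Hqs lj) _ => v; apply: esub_below.
Qed.

Definition start : state fs := State valid_phi_axioms.

(** The given extension variables keep their indices; all variables for bits come after them. *)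
Definition over s := exists E, exts s = phi_axioms ++ E.

Lemma over_grow c s t : grow c s t -> over s -> over t.
Proof. by move=> [[E HE] _ _] [E' HE']; exists (E' ++ E); rewrite HE HE' catA. Qed.

Lemma init : exists s z o, [/\ grow 1020 start s, over s & ready s z o].
Proof.
have [t1 [z [g1 Zz]]] := zero_gate start.
have [t2 [o [g2 Bo Lo]]] := one_gate Zz.
have Zz2 := zerov_grow g2 Zz.
have [t3 g3 K0] := der_exec (der0 Zz2).
have g := grow_trans (grow_trans g1 g2) g3.
exists t3, z, o; split.
- exact: growW g.
- by apply: over_grow g _; exists [::]; rewrite cats0.
- split; last exact: K0.
    split; [exact: zerov_grow g3 Zz2 | exact: bit_grow g3 Bo | exact: grow_mem g3 Lo].
  by have := grow_size g; rewrite /= size_map.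
Qed.

Lemma avail_defined s z o j : ready s z o -> over s ->
  (forall i, (i < j)%N -> avail s (inr i)) -> live j ->
  exists2 t, grow (def_cost L) s t & avail t (inr j).
Proof.
move=> R [E HE] A lj; have /and3P[ltj mj _] := lj.
(* $y_j$ is a monomial of its own axiom, which is a line, so its length is at most that of the
   line. *)
have lenj : (l (inr j) <= L)%N.
  apply: leq_trans (line_len qs mj); have [_ H] := poly_circuit_bounds l (X (inr j) - qs`_j).
  have mt : ucm (inr j) \in msupp (X (inr j) - qs`_j).
    by rewrite -mcoeff_neq0 (axiom_top Hqs ltj).
  apply: leq_trans (H _ mt); have [_ H2 _] := mcirc_bounds l (X (inr j) - qs`_j)@_(ucm (inr j)) (mvars (ucm (inr j))).
  apply: H2; rewrite /mvars mdomU; apply/flatten_mapP; exists (inr j).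
    exact: fset11.
  by rewrite cmUU mem_head.
have lenq : (plen l qs`_j <= L)%N by rewrite -elen_ext.
have me v := mulby_e fs (esub01 qs rs) (@esub_below_size n qs rs) v.
have Pq := poly_size_phi fs (esub01 qs rs) (@esub_below_size n qs rs) lenq.
have ltE : (j < size (exts s))%N by case: R => _ S _; apply: leq_trans ltj S.
have Hnth : (exts s)`_j = phi e qs`_j.
  by rewrite HE nth_cat size_map ltj (nth_map 0).
have [||t1 g1 K1] := @add_line _ _ s (X (inr j) - phi e qs`_j).
- apply: belowB; first exact: belowX.
  by rewrite -Hnth; apply: belowW (ltnW ltE) _; case: (validP s) => H _; apply: H.
- by rewrite -Hnth; apply: StepExtension.
have [|t2 g2 [P [N [BP BN sP sN K2]]]] := rep_poly (q := qs`_j) (esub01 qs rs) me (@l_inl n qs) (ready_grow g1 R) lenq.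
  move=> m v mq /mem_mvars vm; apply: avail_grow g1 _.
  have := below_var (Hqs ltj) mq vm; case: v {vm} => // i; exact: A.
have K1' := grow_mem g2 K1.
have S1 : (poly_size (X (inr j) - phi e qs`_j)%R <= 2 + poly_bound L)%N.
  exact: poly_sizeB_le (poly_size_X_le _) Pq.
have S2 : (poly_size (phi e qs`_j - (binval P - binval N))%R <= poly_bound L + (binval_bound (L + 1) + binval_bound (L + 1)))%N.
  by apply: size_rep_line Pq sP sN _; rewrite leq_add2r.
have D := derD (der_line K1' S1) (der_line K2 S2).
der_as D (X (inr j) - (binval P - binval N)).
have [t3 g3 K3] := der_exec D; exists t3.
  apply: growW (grow_trans (grow_trans g1 g2) g3); rewrite /def_cost.
  move: S1; move: (poly_size _) (poly_bound L) (poly_cost L) (binval_bound _) => x1 x2 x3 x4; lia.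
move=> _; exists P, N; split; [exact: bits_grow g3 BP | exact: bits_grow g3 BN | | | exact: K3].
- by rewrite sP elen_ext.
- by rewrite sN elen_ext.
Qed.

Lemma avail_dead s j : ~~ live j -> avail s (inr j).
Proof. by move=> lj /= /esub_live; rewrite (negPf lj). Qed.

(** Only live variables cost anything. The number of all extension axioms could not be used, as the
    syntactic size does not bound it. *)
Lemma avail_all s z o : ready s z o -> over s ->
  exists2 t, grow (L * (def_cost L)) s t & forall v, avail t v.
Proof.
move=> R O.
suff H k : exists2 t, grow (size [seq j <- iota 0 k | live j] * (def_cost L)) s t
    & forall j, (j < k)%N -> avail t (inr j).
  have [t g A] := H (size qs); exists t.
    by apply: growW g; rewrite leq_mul // (size_live_vars rs Hqs).
  case=> // j; have [lj|lj] := boolP (live j); last exact: avail_dead.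
  by apply: A; case/and3P: lj.
elim: k => [|k [t g A]]; first by exists s => //; exact: grow_refl.
have E : size [seq j <- iota 0 k.+1 | live j] = (size [seq j <- iota 0 k | live j] + live k)%N.
  by rewrite -addn1 iotaD filter_cat size_cat add0n /=; case: (live k).
have step' u : (forall j, (j < k)%N -> avail u (inr j)) -> avail u (inr k) ->
    forall j, (j < k.+1)%N -> avail u (inr j).
  move=> H1 H2 j; rewrite ltnS leq_eqVlt => /orP[/eqP ->|/H1 H3]; [exact: H2 | exact: H3].
rewrite E; have [lk|lk] := boolP (live k); last first.
  rewrite addn0; exists t; first exact: g.
  by apply: step' A _; exact: avail_dead.
have [t2 g2 A2] := avail_defined (ready_grow g R) (over_grow g O) A lk.
exists t2; first by rewrite addn1 mulSnr; exact: grow_trans g g2.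
apply: step' A2 => j lj; exact: avail_grow g2 (A j lj).
Qed.

Lemma phi_fs f : f \in fs -> phi e f = f.
Proof.
move=> /Bfs B; apply: phi_id => m mf v vm; have := below_var B mf vm.
by case: v {vm}.
Qed.

Lemma step_sim c d
  (sqrt_phi : forall s z o q, ready s z o -> (plen l q <= L)%N ->
    (forall m v, m \in msupp q -> v \in mvars m -> avail s v) ->
    phi e q ^+ 2 known_in s ->
    exists2 t, grow (poly_cost L + c * sqrt_scale L ^ d) s t & phi e q known_in t) s z o i :
  ready s z o -> over s -> (forall v, avail s v) -> (i < size rs)%N ->
  (forall p, p \in take i rs -> known s (phi e p)) ->
  exists2 t, grow (poly_bound L + (poly_cost L + c * sqrt_scale L ^ d)) s t & phi e rs`_i known_in t.
Proof.
move=> R [E HE] A li K; have [_ S0 K0] := R.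
have [Br Sr] := Hrs li.
have leni : (plen l rs`_i <= L)%N by apply: line_len; apply: mem_nth.
have Bphi : poly_below (size (exts s)) (phi e rs`_i).
  apply: phi_below (belowW S0 Br) _ => v; exact: esub_below.
have Ps := poly_size_phi fs (esub01 qs rs) (@esub_below_size n qs rs) leni.
have line : step false fs (exts s) (lines s) (phi e rs`_i) ->
    exists2 t, grow (poly_bound L + (poly_cost L + c * sqrt_scale L ^ d)) s t & phi e rs`_i known_in t.
  move=> St; have [t g m] := add_line Bphi St; exists t; last exact: m.
  by apply: growW g; apply: leq_trans Ps (leq_addr _ _).
have zero : phi e rs`_i = 0 ->
    exists2 t, grow (poly_bound L + (poly_cost L + c * sqrt_scale L ^ d)) s t & phi e rs`_i known_in t.
  move=> ->; exists s; last exact: K0.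
  exact: growW (leq0n _) (grow_refl s).
have mem p : p \in take i rs -> phi e p \in lines s by case/K.
have sqrt r : rs`_i = r -> r ^+ 2 \in take i rs ->
    exists2 t, grow (poly_bound L + (poly_cost L + c * sqrt_scale L ^ d)) s t & phi e rs`_i known_in t.
  move=> Er /K Kr; rewrite expr2 phiM -expr2 -Er in Kr.
  have [t g m] := sqrt_phi s z o rs`_i R leni (fun _ v _ _ => A v) Kr.
  by exists t; [apply: growW g; exact: leq_addl | exact: m].
have rsi : rs`_i \in rs by apply: mem_nth.
case: Sr line zero sqrt rsi => [f ff|k|j lj|a b p q Hp Hq|v p Hp|r _ Hr|g M hs M0 hs0 Hg Hh] line zero sqrt rsi.
- by apply: line; rewrite phi_fs //; apply: StepSystem.
- apply: line; rewrite phiB expr2 phiM phiX -expr2; exact: StepBoolean.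
(* For $q_j = 0$ the variable is replaced by 0 and so is the line. Otherwise the variable is live,
   since the axiom is a line. *)
- have [qj|qj] := eqVneq qs`_j 0.
    apply: zero; rewrite phiB phiX qj phi0 subr0 /esub /is_live qj eqxx !andbF; reflexivity.
  have ej : e (inr j) = X (inr j).
    have lvj : live j by apply/and3P; split; [exact: lj | exact: rsi | exact: qj].
    by rewrite /esub lvj.
  apply: line; rewrite phiB phiX ej.
  have -> : phi e qs`_j = (exts s)`_j by rewrite HE nth_cat size_map lj (nth_map 0).
  by apply: StepExtension; apply: leq_trans lj S0.
- apply: line; rewrite phi_lin.
  exact: (@StepLinear _ _ _ _ _ a b _ _ (mem _ Hp) (mem _ Hq)).
- case: (esub01 qs rs v) => Ev.
    apply: line; rewrite phiM phiX Ev; exact: (@StepMul _ _ _ _ _ v _ (mem _ Hp)).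
  by apply: zero; rewrite phiM phiX Ev mul0r.
- exact: sqrt (erefl _) Hr.
- apply: line; apply: (@StepEBVP _ _ _ _ _ (phi e g) M (map (phi e) hs) M0).
  + by rewrite size_map.
  + rewrite size_map; have := mem _ Hg; rewrite phiM phiD phiC phi_sum.
    rewrite (_ : \sum_(k < size hs) _ = \sum_(k < size hs) 2 ^+ k *: [seq phi e h | h <- hs]`_k) //.
    by apply: eq_bigr => k _; rewrite phiZ (nth_map 0).
  + move=> h /mapP [h' /Hh Hh' ->]; have := mem _ Hh'.
    by rewrite phiB expr2 phiM -expr2.
Qed.

Lemma size_undup_rcons (s : seq (epoly n)) x :
  ((x \notin s) + size (undup s) <= size (undup (rcons s x)))%N.
Proof.
have [xs|xs] := boolP (x \in s).
  apply: uniq_leq_size (undup_uniq _) _ => y.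
  by rewrite !mem_undup mem_rcons in_cons => ->; rewrite orbT.
rewrite add1n -[_.+1]/(size (x :: undup s)); apply: uniq_leq_size.
  by rewrite /= mem_undup xs undup_uniq.
by move=> y; rewrite in_cons !mem_undup mem_rcons in_cons.
Qed.

(** A line whose image is already known is skipped, so the cost counts distinct images instead of
    lines. *)
Lemma simulate c d
  (sqrt_phi : forall s z o q, ready s z o -> (plen l q <= L)%N ->
    (forall m v, m \in msupp q -> v \in mvars m -> avail s v) ->
    phi e q ^+ 2 known_in s ->
    exists2 t, grow (poly_cost L + c * sqrt_scale L ^ d) s t & phi e q known_in t) s z o i :
  ready s z o -> over s -> (forall v, avail s v) -> (i <= size rs)%N ->
  exists2 t, grow (size (undup (map (phi e) (take i rs))) * (poly_bound L + (poly_cost L + c * sqrt_scale L ^ d))) s t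
    & forall p, p \in take i rs -> known t (phi e p).
Proof.
move=> R O A; elim: i => [|i IH] li.
  by rewrite take0; exists s; [exact: grow_refl | ].
have [t g K] := IH (ltnW li); rewrite (take_nth 0 li) map_rcons.
have U := size_undup_rcons (map (phi e) (take i rs)) (phi e rs`_i).
have [mi|mi] := boolP (phi e rs`_i \in map (phi e) (take i rs)).
  exists t; first by apply: growW g; rewrite leq_mul2r (leq_trans _ U) ?orbT // leq_addl.
  move=> p; rewrite mem_rcons in_cons => /orP[/eqP ->|/K Kp]; last exact: Kp.
  by case/mapP: mi => p' /K Kp' ->.
have [t2 g2 K2] := step_sim sqrt_phi (ready_grow g R) (over_grow g O)
  (fun v => avail_grow g (A v)) li K.
exists t2.
  apply: growW (grow_trans g g2); rewrite -mulSnr leq_mul2r; apply/orP; right.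
  by apply: leq_trans U; rewrite mi.
move=> p; rewrite mem_rcons in_cons => /orP[/eqP ->|/K Kp]; first exact: K2.
exact: grow_mem g2 Kp.
Qed.

End Simulation.

(** * The polynomial bound and the conclusion *)

Definition total_cost (c d K : nat) : nat :=
  (1020 + K * def_cost K + (2 * K + 3) * (poly_bound K + (poly_cost K + c * sqrt_scale K ^ d)) + (K + 1) * (K + 2))%N.

Lemma total_cost_poly c d : exists c' k', forall K, (total_cost c d K <= c' * (K + 1) ^ k')%N.
Proof.
(* The base is $K + 1$ because sums of bounds need a positive one. *)
eexists; eexists => K; rewrite -/(bnd (K + 1) _ _ _).
have : (K <= K + 1)%N by rewrite leq_addr.
have : (0 < K + 1)%N by rewrite addn1.
rewrite /total_cost /def_cost /sqrt_scale /mulby_bound /poly_cost /term_cost /monomial_cost /factor_cost /mul_cost /mac_cost /pad_cost /add_cost /const_cost /poly_bound /binval_bound.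
move: (K + 1)%N => U U0 KU.
bnd_tac.
Qed.

Lemma monomial_poly (c k : nat) : exists P : {poly nat}, forall x : nat, P.[x] = (c * (x + 1) ^ k)%N.
Proof.
elim: k => [|k [P HP]]; first by exists c%:P => x; rewrite hornerC expn0 muln1.
exists (P * ('X + 1%:P)) => x; rewrite hornerM HP hornerD hornerX hornerC.
by rewrite expnSr mulnA.
Qed.

Theorem theorem3 :
  exists P : {poly nat},
    forall (n : nat) (fs : seq (epoly n)) (S : nat),
      (forall f : epoly n, f \in fs -> poly_below 0 f) ->
      (exists qs rs : seq (epoly n),
          refutation true fs qs rs /\ refutation_syntactic_size qs rs = S) ->
      exists qs rs : seq (epoly n),
        refutation false fs qs rs /\ (refutation_size rs <= P.[S]%R)%N.
Proof.
have [c [d sqrtP]] := sqrt_phi; have [c' [k' bound]] := total_cost_poly c d.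
have [P HP] := monomial_poly c' k'; exists P => n fs S Bfs [qs [rs [[Hqs Hrs [a a0 last_a]] ES]]].
have [s0 [z [o [g0 O0 R0]]]] := init fs rs Hqs.
have [s1 g1 A1] := avail_all Hqs R0 O0.
have R1 := ready_grow g1 R0; have O1 := over_grow g1 O0.
have sq := sqrtP n fs _ _ _ (esub01 qs rs) (@esub_below_size n qs rs) (@l_inl n qs).
have [s2 g2 K2] := simulate Bfs Hrs (sq (refutation_syntactic_size qs rs)) R1 O1 A1 (leqnn _).
rewrite take_size in g2 K2.
(* For an empty [rs] the default value of [last] would give $a = 0$. *)
have a_rs : a%:MP \in rs.
  rewrite -last_a; move: last_a; case: (rs) => [E|r rs' _]; last by rewrite /= mem_last.
  case/eqP: a0; have := congr1 (mcoeff mone) E; rewrite mcoeff0 mcoeffC eqxx; exact: esym.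
have Ka := K2 _ a_rs; rewrite phiC in Ka.
have V : valid fs (exts s2) (rcons (lines s2) a%:MP).
  apply: valid_rcons; first exact: belowC.
  (* The constant is known but need not be the last line, so it is repeated as $1 \cdot a + 0 \cdot
     a$. *)
  case: Ka => Ka; rewrite -[a%:MP]addr0 -[in X in X + _](scale1r a%:MP) -(scale0r a%:MP).
  exact: StepLinear.
exists (exts s2), (rcons (lines s2) a%:MP); split.
  case: V => V1 V2; split; [exact: V1 | exact: V2 |].
  by exists a; [exact: a0 | rewrite last_rcons].
rewrite HP -ES; apply: leq_trans (bound _).
have [_ _ G] := grow_trans (grow_trans g0 g1) g2.
rewrite /refutation_size -cats1 big_cat big_seq1 /= -/(refutation_size _) /total_cost.
apply: leq_add.
  apply: leq_trans G _; rewrite {1}/refutation_size big_nil add0n leq_add // leq_mul //.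
  exact: (size_images rs Hqs).
have pa := line_len qs a_rs.
apply: leq_trans (poly_size_plen (elen qs) _) _.
by rewrite leq_mul // leq_add2r.
Qed.
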